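(* Let $d\ge2$ be an integer, $\sigma^2>0$ and $0<r\le R$ be fixed. Let $b_n=\sqrt{2\sigma^2\ln n}$, $A=2d(d+1)8^{(d-1)/2}$ and $M=\lfloor Ab_n^{d-1}(\ln b_n)^{-(d-2)}\rfloor$. Then the truncated estimator $\tilde G_M$ satisfies, as $n\to\infty$, $$\sup_{G\in\mathcal{K}_{r,R}}\mathbb{E}_G\big[\mathsf{d}_{\mathsf H}(\tilde G_M,G)\big]=O\left(\frac{\ln\ln n}{\sqrt{\ln n}}\right).$$
   Context: A convex body is a convex compact subset of $\mathbb{R}^d$ with nonempty interior; $B_d(a,\rho)$ is the Euclidean ball with center $a$ and radius $\rho$; $\mathbb{S}^{d-1}$ is the unit sphere. $\mathcal{K}_{r,R}$ is the collection of all convex bodies $G\subseteq\mathbb{R}^d$ such that $B_d(a,r)\subseteq G\subseteq B_d(0,R)$ for some $a\in\mathbb{R}^d$. Model: $Y_j=X_j+\varepsilon_j$, $j=1,\ldots,n$, where $X_1,\ldots,X_n$ are i.i.d. uniform in the convex body $G$ and $\varepsilon_1,\ldots,\varepsilon_n$ are i.i.d. $d$-dimensional centered Gaussian vectors with covariance matrix $\sigma^2I$, independent of the $X_j$'s; $\sigma^2$ is known. $\mathbb{E}_G$ denotes expectation under this model (and over the random directions below). Estimator: for $u\in\mathbb{R}^d$, $\hat h(u)=\max_{1\le j\le n}\langle u,Y_j\rangle-b_n$. Let $U_1,\ldots,U_M$ be independent uniform random vectors on $\mathbb{S}^{d-1}$, independent of the data, and $$\hat G_M=\{x\in\mathbb{R}^d:\langle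 U_j,x\rangle\le\hat h(U_j),\ \forall j=1,\ldots,M\}.$$ Let $\hat\mu_n=\frac1n\sum_{j=1}^nY_j$. The truncated estimator is $\tilde G_M=\hat G_M\cap B_d(\hat\mu_n,\ln n)$ if $\hat G_M\ne\emptyset$, and $\tilde G_M=\{\hat\mu_n\}$ otherwise. The Hausdorff distance is $\mathsf{d}_{\mathsf H}(A,B)=\inf\{\epsilon>0: A\subseteq B+\epsilon B_d(0,1)\text{ and }B\subseteq A+\epsilon B_d(0,1)\}$. The constant in $O(\cdot)$ may depend on $d,r,R,\sigma^2$.
   Formalization: The truncated estimator is taken to be the sample mean whenever the polyhedron misses the ball of radius ln n, not only when it is empty; otherwise the estimator is empty with positive probability and its Hausdorff distance to G is infinite. *)

(* Defs.v *)
From HB Require Import structures.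
From mathcomp Require Import all_boot all_order all_algebra.
From mathcomp Require Import all_classical all_reals all_analysis.

Set Implicit Arguments.
Unset Strict Implicit.
Unset Printing Implicit Defensive.

Import Order.TTheory GRing.Theory Num.Theory.
Import numFieldNormedType.Exports.

Local Open Scope classical_set_scope.
Local Open Scope ring_scope.

(* R^d is 'rV[R]_d.  The library norm `|x| on 'rV is the sup norm; it induces
   the usual topology (so [compact] and [interior] are used as they are), but
   every metric notion below goes through the Euclidean norm [enorm]. *)
Section euclidean_space.
Variables (R : realType) (d : nat).
Implicit Types (u v x a : 'rV[R]_d) (A B G : set 'rV[R]_d) (rho e : R).

Definition dotp u v : R := \sum_(i < d) u 0 i * v 0 i.

Definition enorm x : R := Num.sqrt (dotp x x).

Definition eball a rho : set 'rV[R]_d := [set x | enorm (x - a) <= rho].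

Definition enlarge A e : set 'rV[R]_d :=
  [set y + e *: z | y in A & z in eball 0 1].

(* Extended-real valued: the distance to an unbounded set or from the empty
   set to a nonempty one is +oo. *)
Definition hausdorff_dist A B : \bar R :=
  ereal_inf [set e%:E | e in
    [set e : R | [/\ 0 < e, A `<=` enlarge B e & B `<=` enlarge A e]]].

Definition convex_body G : Prop :=
  [/\ convex_set (G : set (convex_lmodType 'rV[R]_d)), compact G &
      G° !=set0].

Definition bodies (r Rad : R) : set (set 'rV[R]_d) :=
  [set G | convex_body G /\
           exists a, eball a r `<=` G /\ G `<=` eball 0 Rad].

End euclidean_space.

Section borel_rV.
Variables (R : realType) (d : nat).

Definition borel_rV : set (set 'rV[R]_d) := <<s open >>.

Let borel0 : borel_rV set0.
Proof. exact: sigma_algebra0. Qed.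

Let borelC A : borel_rV A -> borel_rV (~` A).
Proof. exact: sigma_algebraC. Qed.

Let borel_bigcup (F : (set 'rV[R]_d)^nat) :
  (forall i, borel_rV (F i)) -> borel_rV (\bigcup_i F i).
Proof. exact: sigma_algebra_bigcup. Qed.

HB.instance Definition _ :=
  @isMeasurable.Build (sigma_display (@open 'rV[R]_d)) 'rV[R]_d
    borel_rV borel0 borelC borel_bigcup.

End borel_rV.

(* d-dimensional Lebesgue measure of Borel sets, as an iterated integral
   (Cavalieri/Tonelli): the first coordinate is integrated last. *)
Fixpoint lebesgue_rV (R : realType) (d : nat) : set 'rV[R]_d -> \bar R :=
  match d return set 'rV[R]_d -> \bar R with
  | 0 => fun A => (\1_A 0)%:E
  | d'.+1 => fun A =>
      (\int[@lebesgue_measure R]_x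
         lebesgue_rV [set y : 'rV[R]_d' | A (row_mx (x%:M : 'rV[R]_1) y)])%E
  end.

Section random_vectors.
Variables (R : realType) (d : nat) (disp : measure_display).
Variables (Omega : measurableType disp) (P : probability Omega R).
Implicit Types Z : {RV P >-> 'rV[R]_d}.

Definition uniform_on (G : set 'rV[R]_d) Z : Prop :=
  forall A, measurable A ->
    distribution P Z A = (lebesgue_rV (A `&` G) / lebesgue_rV G)%E.

(* Normalized surface measure on the unit sphere, through polar coordinates:
   sigma(A) is proportional to the volume of the truncated cone
   { t *: u | 0 < t <= 1, u in A, enorm u = 1 }. *)
Definition uniform_on_sphere Z : Prop :=
  forall A, measurable A ->
    distribution P Z A =
      (lebesgue_rV [set x : 'rV[R]_d |
                     (0 < enorm x <= 1)%R /\ A ((enorm x)^-1 *: x)%R]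
       / lebesgue_rV (eball (0 : 'rV[R]_d) 1))%E.

(* Centered Gaussian vector with covariance matrix sigma^2 I: every nonzero
   linear form <u, Z> is N(0, u (sigma^2 I) u^T).  The second parameter of
   [normal_prob] is the standard deviation. *)
Definition isotropic_gaussian (sigma : R) Z : Prop :=
  forall (u : 'rV[R]_d) (B : set R), u != 0 -> measurable B ->
    P [set w | B (dotp u (Z w))] = normal_prob 0 (sigma * enorm u) B.

(* Taking some of the A i equal to setT gives the product rule for every
   subfamily. *)
Definition mutually_independent (I : finType)
    (Z : I -> {RV P >-> 'rV[R]_d}) : Prop :=
  forall A : I -> set 'rV[R]_d, (forall i, measurable (A i)) ->
    P (\bigcap_(i in [set: I]) (Z i @^-1` A i)) =
    (\prod_(i : I) P (Z i @^-1` A i))%E.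

Definition noisy_body_model (sigma : R) (G : set 'rV[R]_d) (n M : nat)
    (X eps : 'I_n -> {RV P >-> 'rV[R]_d})
    (U : 'I_M -> {RV P >-> 'rV[R]_d}) : Prop :=
  [/\ forall j, uniform_on G (X j),
      forall j, isotropic_gaussian sigma (eps j),
      forall k, uniform_on_sphere (U k) &
      mutually_independent (fun i : 'I_n + 'I_n + 'I_M =>
        match i with
        | inl (inl j) => X j
        | inl (inr j) => eps j
        | inr k => U k
        end)].

End random_vectors.

Section estimator.
Variables (R : realType) (d n M : nat).
Variables (b : R) (Y : 'I_n -> 'rV[R]_d) (U : 'I_M -> 'rV[R]_d).

(* For n > 0 the supremum is over a finite nonempty set, hence a maximum. *)
Definition support_est (u : 'rV[R]_d) : R :=
  sup [set dotp u (Y j) | j in [set: 'I_n]] - b.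

Definition polyhedral_est : set 'rV[R]_d :=
  [set x | forall k, dotp (U k) x <= support_est (U k)].

Definition sample_mean : 'rV[R]_d := n%:R^-1 *: \sum_(j < n) Y j.

(* The fallback is used as soon as the truncated polyhedron is empty.  Testing
   only polyhedral_est = set0 would not do: with positive probability the
   polyhedron is nonempty but misses the ball, and the resulting empty
   estimator would have Hausdorff distance +oo to G. *)
Definition truncated_est : set 'rV[R]_d :=
  let T := polyhedral_est `&` eball sample_mean (ln n%:R) in
  if `[< T !=set0 >] then T else [set sample_mean].

End estimator.

Section risk.
Variables (R : realType) (d : nat) (sigma : R) (n : nat).

Definition bn : R := Num.sqrt (2 * sigma ^+ 2 * ln n%:R).

(* Only used for d >= 2, where d.-1 and d.-2 are true subtractions. *)
Definition nb_directions : nat :=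
  let A : R := 2 * d%:R * (d%:R + 1) * 8 `^ (d.-1%:R / 2) in
  Num.truncn (A * bn ^+ d.-1 * (ln bn) ^- d.-2).

(* The law of (X, eps, U), hence the value of the expectation, is determined by
   G; the model is not tied to a particular probability space. *)
Definition risks (G : set 'rV[R]_d) : set (\bar R) :=
  [set E | exists (disp : measure_display) (Omega : measurableType disp)
             (P : probability Omega R)
             (X eps : 'I_n -> {RV P >-> 'rV[R]_d})
             (U : 'I_nb_directions -> {RV P >-> 'rV[R]_d}),
       noisy_body_model sigma G X eps U /\
       E = (\int[P]_w hausdorff_dist
              (truncated_est bn (fun j => (X j w + eps j w)%R) (U ^~ w)) G)%E].

Definition maximal_risk (r Rad : R) : \bar R :=
  ereal_sup (\bigcup_(G in bodies r Rad) risks G).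

End risk.

(* Main.v *)
Require Import Defs.
From HB Require Import structures.
From mathcomp Require Import all_boot all_order all_algebra.
From mathcomp Require Import all_classical all_reals all_analysis.
From mathcomp Require Import measurable_realfun.
From mathcomp Require Import ring lra.

(* Let b = b_n and let t = K (ln b / b) for a large constant K.  With probability
   1 - O(b^-4):
   - no noise <v, eps_j>, v in a net of mesh b^-2 of the sphere, exceeds b + t
     (Gaussian upper tail and union bound);
   - for every v of the net some X_j lies in the cap of height t of G in the
     direction v while <v, eps_j> >= b - t: caps have probability of order t^d,
     and the Gaussian lower tail makes the expected number of such j a large
     power of b;
   - every v of the net is within t of a random direction U_k: a spherical cap
     of radius t has probability of order t^(d-1), so that about K^(d-1) ln b of
     the U_k fall in it.
   The first two facts give |hhat - h_G| = O(t) on the whole sphere, and then the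
   third one gives d_H(G~, G) = O(t): a point of the estimator at distance D from
   G violates the constraint of a direction close to the one of its projection
   unless D = O(t), and a point of G moved by O(t) towards the centre of the
   inner ball satisfies all the constraints.  On the exceptional event the loss
   is at most 2R + ln n plus the norm of the mean noise, and
   |x| <= kappa + x^2 / kappa with kappa = b makes its contribution O(1/b). *)

Set Implicit Arguments.
Unset Strict Implicit.
Unset Printing Implicit Defensive.

Import Order.TTheory GRing.Theory Num.Theory.
Import numFieldNormedType.Exports.

Local Open Scope classical_set_scope.
Local Open Scope ring_scope.

(** * Euclidean geometry *)

Section euclid.
Variables (R : realType) (d : nat).
Implicit Types (u v x y : 'rV[R]_d) (G : set 'rV[R]_d).

Lemma dotpC u v : dotp u v = dotp v u.
Proof. by apply: eq_bigr => i _; rewrite mulrC. Qed.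

Lemma dotpDr u x y : dotp u (x + y) = dotp u x + dotp u y.
Proof. by rewrite /dotp -big_split; apply: eq_bigr => i _; rewrite mxE mulrDr. Qed.

Lemma dotpZr u k x : dotp u (k *: x) = k * dotp u x.
Proof. by rewrite /dotp mulr_sumr; apply: eq_bigr => i _; rewrite mxE mulrCA. Qed.

Lemma dotpNr u x : dotp u (- x) = - dotp u x.
Proof. by rewrite -scaleN1r dotpZr mulN1r. Qed.

Lemma dotpBr u x y : dotp u (x - y) = dotp u x - dotp u y.
Proof. by rewrite dotpDr dotpNr. Qed.

Lemma dotpDl u x y : dotp (x + y) u = dotp x u + dotp y u.
Proof. by rewrite dotpC dotpDr !(dotpC u). Qed.

Lemma dotpZl u k x : dotp (k *: x) u = k * dotp x u.
Proof. by rewrite dotpC dotpZr dotpC. Qed.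

Lemma dotpBl u x y : dotp (x - y) u = dotp x u - dotp y u.
Proof. by rewrite dotpC dotpBr !(dotpC u). Qed.

Lemma dotp0r u : dotp u 0 = 0.
Proof. by rewrite -(scale0r 0) dotpZr mul0r. Qed.

Lemma dotpp_ge0 x : 0 <= dotp x x.
Proof. by apply: sumr_ge0 => i _; rewrite -expr2 sqr_ge0. Qed.

Lemma enorm_ge0 x : 0 <= enorm x.
Proof. exact: sqrtr_ge0. Qed.

Lemma enorm_sqr x : enorm x ^+ 2 = dotp x x.
Proof. by rewrite sqr_sqrtr// dotpp_ge0. Qed.

Lemma enormZ k x : enorm (k *: x) = `|k| * enorm x.
Proof.
by rewrite /enorm dotpZr dotpZl mulrA -expr2 sqrtrM ?sqr_ge0// sqrtr_sqr.
Qed.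

Lemma enormN x : enorm (- x) = enorm x.
Proof. by rewrite -scaleN1r enormZ normrN1 mul1r. Qed.

Lemma enormB x y : enorm (x - y) = enorm (y - x).
Proof. by rewrite -enormN opprB. Qed.

Lemma enorm0 : enorm (0 : 'rV[R]_d) = 0.
Proof. by rewrite /enorm dotp0r sqrtr0. Qed.

Lemma coord_le_enorm x i : `|x 0 i| <= enorm x.
Proof.
rewrite -sqrtr_sqr ler_sqrt ?dotpp_ge0// /dotp (bigD1 i)//= -expr2 lerDl.
by apply: sumr_ge0 => j _; rewrite -expr2 sqr_ge0.
Qed.

Lemma enorm_eq0 x : (enorm x == 0) = (x == 0).
Proof.
apply/eqP/eqP => [x0|->]; last exact: enorm0.
apply/rowP => i; rewrite mxE; apply/eqP; rewrite -normr_le0 -x0.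
exact: coord_le_enorm.
Qed.

Lemma enorm_gt0 x : (0 < enorm x) = (x != 0).
Proof. by rewrite lt_def enorm_eq0 enorm_ge0 andbT. Qed.

Lemma cauchy_schwarz u v : dotp u v <= enorm u * enorm v.
Proof.
have [->|u0] := eqVneq u 0; first by rewrite dotpC dotp0r enorm0 mul0r.
have [->|v0] := eqVneq v 0; first by rewrite dotp0r enorm0 mulr0.
(* This square equals 2|u||v| (|u||v| - <u,v>), and |u||v| > 0. *)
have := dotpp_ge0 (enorm v *: u - enorm u *: v).
rewrite dotpBr !dotpBl !dotpZl !dotpZr -!enorm_sqr (dotpC v u).
have : 0 < enorm u * enorm v by rewrite mulr_gt0// enorm_gt0.
by nra.
Qed.

Lemma ler_enormD x y : enorm (x + y) <= enorm x + enorm y.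
Proof.
rewrite -(@ler_pXn2r _ 2)// ?nnegrE ?addr_ge0 ?enorm_ge0//.
rewrite enorm_sqr dotpDr !dotpDl (dotpC y x) -!enorm_sqr.
by have := cauchy_schwarz x y; lra.
Qed.

Lemma ler_enormB x y : enorm (x - y) <= enorm x + enorm y.
Proof. by rewrite -(enormN y) ler_enormD. Qed.

Lemma enorm_le_sum x : enorm x <= \sum_(i < d) `|x 0 i|.
Proof.
rewrite -(@ler_pXn2r _ 2)// ?nnegrE ?enorm_ge0 ?sumr_ge0//.
rewrite enorm_sqr expr2 mulr_suml ler_sum// => i _.
rewrite -expr2 -real_normK ?num_real// expr2 ler_wpM2l// (bigD1 i)//= lerDl.
exact: sumr_ge0.
Qed.

Lemma enorm_le_max x c : (forall i, `|x 0 i| <= c) -> enorm x <= d%:R * c.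
Proof.
move=> xc; apply: (le_trans (enorm_le_sum x)).
apply: (le_trans (ler_sum _ (fun i _ => xc i))).
by rewrite sumr_const card_ord mulr_natl.
Qed.

Lemma abs_dotp_le u v : `|dotp u v| <= enorm u * enorm v.
Proof.
by rewrite ler_norml cauchy_schwarz lerNl -dotpNr -(enormN v) cauchy_schwarz.
Qed.

Lemma ler_enorm_sum (I : finType) (f : I -> 'rV[R]_d) :
  enorm (\sum_i f i) <= \sum_i enorm (f i).
Proof.
elim/big_ind2 : _ => [|a b x y ab xy|//]; first by rewrite enorm0.
by apply: (le_trans (ler_enormD _ _)); exact: lerD.
Qed.

Lemma enorm_normalize x : x != 0 -> enorm ((enorm x)^-1 *: x) = 1.
Proof.
by move=> x0; rewrite enormZ gtr0_norm ?invr_gt0 ?enorm_gt0// mulVf// enorm_eq0.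
Qed.

Lemma continuous_dotp u : continuous (dotp u).
Proof.
apply: (@continuous_big _ _ +%R 0); first exact: add_continuous.
move=> i _ x.
apply: (@cvgM _ _ _ _ (fun=> u 0 i) (fun y : 'rV[R]_d => y 0 i)).
- exact: nbhs_filter.
- exact: cst_continuous.
- exact: coord_continuous.
Qed.

Lemma continuous_enormB a : continuous (fun x : 'rV[R]_d => enorm (x - a)).
Proof.
move=> x; apply: (@continuous_comp _ _ _ (fun x : 'rV[R]_d => dotp (x - a) (x - a))
  (@Num.sqrt R)); last exact: sqrt_continuous.
apply: (@continuous_big _ _ +%R 0); first exact: add_continuous.
move=> i _ {}x.
have c : (fun y : 'rV[R]_d => (y - a) 0 i) @ x --> (x - a) 0 i.
  rewrite (_ : (fun y : 'rV[R]_d => (y - a) 0 i) = (fun y => y 0 i - a 0 i));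
    last by apply/funext => y; rewrite !mxE.
  rewrite !mxE; apply: (@cvgB _ R^o _ _ _ (fun y : 'rV[R]_d => y 0 i) (fun=> a 0 i)).
  - exact: nbhs_filter.
  - exact: coord_continuous.
  - exact: cst_continuous.
apply: (@cvgM _ _ _ _ (fun y : 'rV[R]_d => (y - a) 0 i) (fun y : 'rV[R]_d => (y - a) 0 i)).
- exact: nbhs_filter.
- exact: c.
- exact: c.
Qed.

Lemma closed_eball a rho : closed (eball a rho : set 'rV[R]_d).
Proof.
rewrite /eball (_ : [set x | _] = (fun x : 'rV[R]_d => enorm (x - a)) @^-1` [set y | y <= rho])//.
apply: preimage_closed; last exact: closed_le.
by move=> x _; exact: continuous_enormB.
Qed.

Lemma enlarge_of_near (A B : set 'rV[R]_d) e : 0 < e ->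
  (forall x, A x -> exists2 y, B y & enorm (x - y) <= e) -> A `<=` enlarge B e.
Proof.
move=> e0 AB x /AB[y By xy]; exists y => //; exists (e^-1 *: (x - y)).
  rewrite /eball/= subr0 enormZ gtr0_norm ?invr_gt0//.
  by rewrite -ler_pdivlMl ?invr_gt0// invrK mulr1.
by rewrite scalerA divff ?gt_eqF// scale1r subrKC.
Qed.

Lemma hausdorff_dist_le (A B : set 'rV[R]_d) e : 0 < e ->
  (forall x, A x -> exists2 y, B y & enorm (x - y) <= e) ->
  (forall x, B x -> exists2 y, A y & enorm (x - y) <= e) ->
  (hausdorff_dist A B <= e%:E)%E.
Proof.
move=> e0 AB BA; apply: ereal_inf_lbound; exists e => //.
by split => //; exact: enlarge_of_near.
Qed.

Lemma hausdorff_dist_ge0 (A B : set 'rV[R]_d) : (0 <= hausdorff_dist A B)%E.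
Proof.
by apply/le_ereal_inf_tmp => _ [e [e0 _ _]] <-; rewrite lee_fin ltW.
Qed.

End euclid.

(** * Support functions and polyhedral approximation *)

Section support.
Variables (R : realType) (d : nat).
Implicit Types (u v x y a p : 'rV[R]_d) (G : set 'rV[R]_d).

Lemma convex_segment G x y (t : R) :
  convex_set (G : set (convex_lmodType 'rV[R]_d)) -> G x -> G y ->
  0 <= t <= 1 -> G (x + t *: (y - x)).
Proof.
move=> cG Gx Gy /andP[t0 t1].
(* Convexity is stated with a weight bundled in the interval type [0,1]: here weight t on y and 1 -
   t on x. *)
have i01 : Itv.spec (@Itv.num_sem R) (Itv.Real `[0%Z, 1%Z]) t.
  by apply/andP; split; rewrite ?num_real //= in_itv/= t0 t1.
have /set_mem := cG y x (Itv.mk i01) (mem_set Gy) (mem_set Gx).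
congr G; change (t *: y + (1 - t) *: x = x + t *: (y - x)).
rewrite scalerBl scale1r scalerBr.
by rewrite addrCA.
Qed.

Definition suppf G u : R := sup [set dotp u x | x in G].

Lemma suppf_ub G (rho : R) u x : G `<=` eball 0 rho -> G x ->
  dotp u x <= suppf G u.
Proof.
move=> GR Gx; apply: sup_upper_bound; last by exists x.
split; first by exists (dotp u x), x.
exists (enorm u * rho) => _ [y Gy <-].
apply: (le_trans (cauchy_schwarz _ _)); rewrite ler_wpM2l ?enorm_ge0//.
by have := GR _ Gy; rewrite /eball/= subr0.
Qed.

Lemma suppf_attained G u : compact G -> G !=set0 ->
  exists2 p, G p & forall x, G x -> dotp u x <= dotp u p.
Proof.
move=> cG G0.
have [|p /set_mem Gp pmax] := @compact_EVT_max _ _ (dotp u) _ G0 cG.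
  exact/continuous_subspaceT/continuous_dotp.
by exists p => // x Gx; apply/pmax/mem_set.
Qed.

Lemma suppf_max G u p : G p -> (forall x, G x -> dotp u x <= dotp u p) ->
  suppf G u = dotp u p.
Proof.
move=> Gp pmax; apply/le_anti/andP; split.
  apply: ge_sup; first by exists (dotp u p), p.
  by move=> _ [x Gx <-]; exact: pmax.
apply: sup_upper_bound; last by exists p.
split; first by exists (dotp u p), p.
by exists (dotp u p) => _ [x Gx <-]; exact: pmax.
Qed.

Lemma suppf_lip G (rho : R) u v : compact G -> G !=set0 -> G `<=` eball 0 rho ->
  suppf G u <= suppf G v + rho * enorm (u - v).
Proof.
move=> cG G0 GR; have [p Gp pmax] := suppf_attained u cG G0.
rewrite (suppf_max Gp pmax) -[in leLHS](subrK v u) dotpDl addrC.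
apply: lerD; first exact: suppf_ub GR Gp.
apply: (le_trans (cauchy_schwarz _ _)).
rewrite mulrC ler_wpM2r ?enorm_ge0//.
by have := GR _ Gp; rewrite /eball/= subr0.
Qed.

Lemma projection G x : compact G -> G !=set0 ->
  convex_set (G : set (convex_lmodType 'rV[R]_d)) ->
  exists2 p, G p & forall g, G g -> dotp (x - p) (g - p) <= 0.
Proof.
move=> cG G0 vG.
have [|p /set_mem Gp pmin] := @compact_EVT_min _ _ (fun y => enorm (y - x)) _ G0 cG.
  exact/continuous_subspaceT/continuous_enormB.
exists p => // g Gg; rewrite leNgt; apply/negP => c0.
set c := dotp _ _ in c0.
(* Minimality of the distance at p along the segment from p to g: |x-p|^2 <= |x-p|^2 - 2tc + t^2
   |g-p|^2, divided by t. *)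
have key (t : R) : 0 < t <= 1 -> 2 * c <= t * dotp (g - p) (g - p).
  move=> /andP[t0 t1].
  have Gt : G (p + t *: (g - p)) by apply: convex_segment => //; rewrite ltW.
  have := pmin _ (mem_set Gt).
  rewrite -(@ler_pXn2r _ 2)// ?nnegrE ?enorm_ge0// enormB.
  rewrite [in X in _ <= X -> _]enormB !enorm_sqr.
  rewrite (_ : x - (p + t *: (g - p)) = (x - p) - t *: (g - p)); last first.
    by rewrite opprD addrA.
  rewrite (dotpBr (x - p - _)) !(dotpBl _ (x - p)) !dotpZl !dotpZr.
  rewrite (dotpC (g - p) (x - p)) -/c => h.
  by rewrite -(ler_pM2l t0); lra.
(* The best t is c / |g-p|^2 when it is below 1, and t = 1 otherwise; both contradict c > 0. *)
have [Nc|cN] := leP (dotp (g - p) (g - p)) c.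
  by have := key 1; rewrite ltr01 lexx => /(_ isT); lra.
have N0 : 0 < dotp (g - p) (g - p) by exact: lt_trans cN.
have := key (c / dotp (g - p) (g - p)).
rewrite divfK ?gt_eqF// divr_gt0//= ler_pdivrMr// mul1r ltW// => /(_ isT).
by lra.
Qed.

Lemma suppf_inner_ball G a (r rho : R) u : G `<=` eball 0 rho -> 0 <= r ->
  eball a r `<=` G -> enorm u = 1 -> dotp u a + r <= suppf G u.
Proof.
move=> GR r0 aG u1; have : G (a + r *: u).
  by apply: aG; rewrite /eball/= addrC addKr enormZ u1 mulr1 ger0_norm.
move/(suppf_ub u GR); rewrite dotpDr dotpZr -enorm_sqr u1.
by rewrite expr1n mulr1.
Qed.

(** Let p be the projection of x, D = |x-p| and v the unit vector along x-p, so that p maximises v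
    over G. A direction U_k within delta of v gives D (1 - delta) <= <U_k, x-p> <= 2 rho delta +
    eta, and 1 - delta >= 1/2. *)
Lemma near_body_of_constraints G (rho delta eta : R) (M : nat) (U : 'I_M -> 'rV[R]_d) x :
  compact G -> G !=set0 -> convex_set (G : set (convex_lmodType 'rV[R]_d)) ->
  G `<=` eball 0 rho -> 0 <= rho -> 0 <= eta -> 0 <= delta <= 2^-1 ->
  (forall v, enorm v = 1 -> exists k, enorm (U k - v) <= delta) ->
  (forall k, dotp (U k) x <= suppf G (U k) + eta) ->
  exists2 g, G g & enorm (x - g) <= 2 * (2 * rho * delta + eta).
Proof.
move=> cG G0 vG GR rho0 eta0 /andP[d0 d1] Ucov Ux.
have [p Gp pproj] := projection x cG G0 vG.
exists p => //; have [->|xp] := eqVneq (x - p) 0.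
  by rewrite enorm0 !mulr_ge0 ?addr_ge0// !mulr_ge0.
set D := enorm (x - p).
have D0 : 0 < D by rewrite enorm_gt0.
set v := D^-1 *: (x - p).
have v1 : enorm v = 1 by rewrite enorm_normalize.
have [k Ukv] := Ucov v v1.
have pmax g : G g -> dotp v g <= dotp v p.
  by move=> /pproj; rewrite dotpBr subr_le0 !dotpZl ler_pM2l// invr_gt0.
have hk : suppf G (U k) <= dotp v p + rho * delta.
  rewrite -(suppf_max Gp pmax); apply: (le_trans (suppf_lip _ v cG G0 GR)).
  by rewrite lerD2l ler_wpM2l.
have pk : dotp v p - rho * delta <= dotp (U k) p.
  rewrite -[in leRHS](subrK v (U k)) dotpDl addrC lerD2r.
  have := abs_dotp_le (U k - v) p; rewrite ler_norml => /andP[+ _].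
  apply: le_trans; rewrite lerN2 mulrC; apply: ler_pM; rewrite ?enorm_ge0//.
  by have := GR _ Gp; rewrite /eball/= subr0.
have Uxp : D * (1 - delta) <= dotp (U k) (x - p).
  have vx : dotp v (x - p) = D.
    by rewrite /v dotpZl -enorm_sqr -/D expr2 mulrA mulVf ?mul1r// gt_eqF.
  rewrite -[in leRHS](subrK v (U k)) dotpDl vx.
  have := abs_dotp_le (U k - v) (x - p); rewrite ler_norml -/D => /andP[+ _].
  have : enorm (U k - v) * D <= delta * D by rewrite ler_pM2r.
  by lra.
have := Ux k; rewrite dotpBr in Uxp.
by nra.
Qed.

Lemma body_near_constraints G a (r rho eta : R) g :
  convex_set (G : set (convex_lmodType 'rV[R]_d)) ->
  G `<=` eball 0 rho -> eball a r `<=` G -> 0 < r -> 0 <= eta <= r ->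
  G g ->
  exists x, [/\ G x, enorm (x - g) <= eta / r * (2 * rho) &
    forall u, enorm u = 1 -> dotp u x <= suppf G u - eta].
Proof.
move=> vG GR aG r0 /andP[eta0 etar] Gg.
have Ga : G a by apply: aG; rewrite /eball/= subrr enorm0 ltW.
have t1 : 0 <= eta / r <= 1.
  by rewrite divr_ge0 ?(ltW r0)//= ler_pdivrMr// mul1r.
(* Moving g towards the centre of the inner ball lowers every <u, g> enough. *)
exists (g + (eta / r) *: (a - g)); split.
- exact: convex_segment.
- rewrite addrC addKr enormZ ger0_norm ?divr_ge0 ?(ltW r0)//.
  rewrite ler_wpM2l ?divr_ge0 ?(ltW r0)//; apply: (le_trans (ler_enormB _ _)).
  have := GR _ Ga; have := GR _ Gg; rewrite /eball/= !subr0.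
  by lra.
- move=> u u1; rewrite dotpDr dotpZr dotpBr.
  (* With tau = eta / r, <u,x> <= (1 - tau) h + tau (h - r) = h - eta, where h is the support
     function at u. *)
  have ha := suppf_inner_ball GR (ltW r0) aG u1.
  have hg := suppf_ub u GR Gg.
  have e : eta = eta / r * r by rewrite divfK// gt_eqF.
  move/andP: t1 => [t0 t1].
  by rewrite [in leRHS]e; nra.
Qed.

End support.

(** * Deterministic bounds on the Hausdorff loss *)

Section deterministic_risk.
Variables (R : realType) (d n M : nat).
Variables (Y : 'I_n -> 'rV[R]_d) (U : 'I_M -> 'rV[R]_d) (b : R).
Hypothesis n0 : (0 < n)%N.

Lemma support_est_ub u j : dotp u (Y j) <= support_est b Y u + b.
Proof.
rewrite /support_est subrK; apply: sup_upper_bound; last by exists j.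
split; first by exists (dotp u (Y j)), j.
exists (\sum_(k < n) `|dotp u (Y k)|) => _ [k _ <-].
rewrite (bigD1 k)//= (le_trans (ler_norm _))// lerDl.
by apply: sumr_ge0.
Qed.

Lemma support_est_le u c : (forall j, dotp u (Y j) <= c + b) ->
  support_est b Y u <= c.
Proof.
move=> h; rewrite /support_est lerBlDr; apply: ge_sup.
  by exists (dotp u (Y (Ordinal n0))), (Ordinal n0).
by move=> _ [j _ <-].
Qed.

Lemma support_est_lip (L : R) u v : (forall j, enorm (Y j) <= L) ->
  support_est b Y u <= support_est b Y v + enorm (u - v) * L.
Proof.
move=> YL; apply: support_est_le => j.
rewrite -[in leLHS](subrK v u) dotpDl addrC addrAC.
apply: lerD; first exact: support_est_ub.
apply: (le_trans (cauchy_schwarz _ _)).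
by rewrite ler_wpM2l ?enorm_ge0.
Qed.

(** A point of G moved inwards satisfies all the constraints and stays in the truncating ball
    because |mean| + rho <= ln n; hence the fallback is not taken. Conversely, points of the
    estimator satisfy the constraints of G up to eta. The bound adds the two one-sided errors. *)
Lemma hausdorff_truncated_est_good G a (r rho delta eta : R) :
  convex_body G -> eball a r `<=` G -> G `<=` eball 0 rho ->
  0 < r -> 0 < eta <= r -> 0 <= delta <= 2^-1 ->
  (forall k, enorm (U k) = 1) ->
  (forall v, enorm v = 1 -> exists k, enorm (U k - v) <= delta) ->
  (forall u, enorm u = 1 -> `|support_est b Y u - suppf G u| <= eta) ->
  enorm (sample_mean Y) + rho <= ln n%:R ->
  (hausdorff_dist (truncated_est b Y U) G <=
    (2 * (2 * rho * delta + eta) + eta / r * (2 * rho))%:E)%E.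
Proof.
move=> [vG cG iG] aG GR r0 /andP[eta0 etar] dlt U1 Ucov hest mu.
have G0 : G !=set0.
  by exists a; apply: aG; rewrite /eball/= subrr enorm0 ltW.
have rho0 : 0 <= rho.
  case: G0 => g /GR; rewrite /eball/= => h; exact: le_trans (enorm_ge0 _) h.
have sub g : G g -> exists2 x, (polyhedral_est b Y U `&` eball (sample_mean Y) (ln n%:R)) x
   & enorm (g - x) <= eta / r * (2 * rho).
  move=> Gg; have [|x [Gx xg xc]] := body_near_constraints vG GR aG r0 _ Gg (eta := eta).
    by rewrite ltW.
  exists x; last by rewrite enormB.
  split.
    move=> k; have := hest _ (U1 k); rewrite ler_norml => /andP[+ _].
    by have := xc _ (U1 k); lra.
  rewrite /eball/=; apply: (le_trans (ler_enormB _ _)).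
  have := GR _ Gx; rewrite /eball/= subr0; lra.
have Tn : polyhedral_est b Y U `&` eball (sample_mean Y) (ln n%:R) !=set0.
  by case: G0 => g /sub[x]; exists x.
have e0 : 0 <= eta / r * (2 * rho).
  by rewrite mulr_ge0 ?divr_ge0 ?mulr_ge0// ltW.
have e1 : 0 <= 2 * rho * delta.
  by case/andP: dlt => dlt0 _; rewrite !mulr_ge0.
rewrite /truncated_est asboolT//; apply: hausdorff_dist_le.
- by lra.
- move=> x [xU _].
  have [|g Gg xg] := near_body_of_constraints cG G0 vG GR rho0 (ltW eta0) dlt Ucov (x := x).
    move=> k; have := hest _ (U1 k); rewrite ler_norml => /andP[_ h].
    by have := xU k; lra.
  by exists g => //; lra.
- by move=> g /sub[x Tx xg]; exists x => //; lra.
Qed.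

(** Truncation and fallback both leave a nonempty set in the ball of radius ln n around the sample
    mean, whatever the sample, so any two points of the estimator and of G are this close. *)
Lemma hausdorff_truncated_est_crude G (rho : R) : G !=set0 ->
  G `<=` eball 0 rho -> (1 < n)%N ->
  (hausdorff_dist (truncated_est b Y U) G <=
    (enorm (sample_mean Y) + rho + ln n%:R)%:E)%E.
Proof.
move=> [g0 Gg0] GR n1; set mu := sample_mean Y.
have l0 : 0 < ln (n%:R : R) by rewrite ln_gt0// ltr1n.
have rho0 : 0 <= rho by have := GR _ Gg0; exact: le_trans (enorm_ge0 _).
have [Tmu [t0 Tt0]] : (truncated_est b Y U `<=` eball mu (ln n%:R)) /\
    truncated_est b Y U !=set0.
  rewrite /truncated_est; case: asboolP => [Tn|_]; first by split => // x [].
  split; last by exists mu.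
  by move=> _ ->; rewrite /eball/= subrr enorm0 ltW.
have near t g : truncated_est b Y U t -> G g ->
    enorm (t - g) <= enorm mu + rho + ln n%:R.
  move=> /Tmu + /GR; rewrite /eball/= subr0 => h1 h2.
  rewrite -[t](subrK mu); have := ler_enormD (t - mu) (mu - g).
  by have := ler_enormB mu g; rewrite addrA; lra.
apply: hausdorff_dist_le.
- by have := enorm_ge0 mu; lra.
- by move=> t Tt; exists g0 => //; exact: near.
- by move=> g Gg; exists t0 => //; rewrite enormB; exact: near.
Qed.

End deterministic_risk.

(** * Lebesgue measure on row vectors *)

Section lower_integral.
Variables (disp : measure_display) (T : measurableType disp) (R : realType).
Variable mu : {measure set T -> \bar R}.
Implicit Types f g h : T -> \bar R.
Local Open Scope ereal_scope.
Import HBNNSimple.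

(* The integral of a nonnegative function is the supremum of the integrals of
   the simple functions below it, hence is monotone and superadditive even
   without measurability. *)
Lemma ge0_le_integral_nomeas f g : (forall x, 0 <= f x) ->
  (forall x, f x <= g x) -> \int[mu]_x f x <= \int[mu]_x g x.
Proof.
move=> f0 fg; rewrite !ge0_integralTE//; last first.
  by move=> x; exact: le_trans (fg x).
apply: le_ereal_sup => _ [h hf <-]; exists h => // x.
exact: le_trans (hf x) (fg x).
Qed.

Lemma ge0_integral_superadd f g h : (forall x, 0 <= f x) ->
  (forall x, 0 <= g x) -> (forall x, f x + g x <= h x) ->
  \int[mu]_x f x + \int[mu]_x g x <= \int[mu]_x h x.
Proof.
move=> f0 g0 fgh.
have h0 x : 0 <= h x by apply: le_trans (fgh x); exact: adde_ge0.
have [->|hoo] := eqVneq (\int[mu]_x h x) +oo; first by rewrite leey.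
(* Finiteness allows subtraction, so the suprema over simple h1 <= f and h2 <= g can be taken one
   after the other; h1 + h2 is then a simple function below h. *)
have hfin : \int[mu]_x h x \is a fin_num.
  by rewrite ge0_fin_numE ?integral_ge0// lt_neqAle hoo leey.
have gfin : \int[mu]_x g x \is a fin_num.
  rewrite ge0_fin_numE ?integral_ge0//.
  apply: (@le_lt_trans _ _ (\int[mu]_x h x)); last by rewrite ltey_eq hfin.
  apply: ge0_le_integral_nomeas => // x; apply: le_trans (fgh x).
  by rewrite leeDr.
rewrite -leeBrDr//; rewrite [leLHS]ge0_integralTE//.
apply/ge_ereal_sup => _ [h1 h1f <-]; rewrite leeBrDr//.
have h1fin : sintegral mu h1 \is a fin_num.
  rewrite ge0_fin_numE ?sintegral_ge0//.
  apply: (@le_lt_trans _ _ (\int[mu]_x h x)); last by rewrite ltey_eq hfin.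
  rewrite ge0_integralTE//; apply: ereal_sup_ubound; exists h1 => // x.
  by apply: (le_trans (h1f x)); apply: le_trans (fgh x); rewrite leeDl.
rewrite addeC -leeBrDr//; rewrite [leLHS]ge0_integralTE//.
apply/ge_ereal_sup => _ [h2 h2g <-]; rewrite leeBrDr//.
rewrite -sintegralD ge0_integralTE//; apply: ereal_sup_ubound.
exists (h2 \+ h1)%R => // x; apply: le_trans (fgh x).
by rewrite /= EFinD addeC; apply: leeD.
Qed.

End lower_integral.

Section lebesgue_rV_theory.
Variable R : realType.
Local Open Scope ereal_scope.

Lemma lebesgue_rV_ge0 d (A : set 'rV[R]_d) : 0 <= lebesgue_rV A.
Proof.
elim: d A => [|d IH] A /=; first by rewrite lee_fin indicE.
by apply: integral_ge0 => x _; exact: IH.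
Qed.

Lemma le_lebesgue_rV d (A B : set 'rV[R]_d) : A `<=` B ->
  lebesgue_rV A <= lebesgue_rV B.
Proof.
elim: d A B => [|d IH] A B AB /=.
  rewrite lee_fin !indicE ler_nat; case: (boolP (0%R \in A)) => // /set_mem/AB.
  by move/mem_set ->.
apply: ge0_le_integral_nomeas => x; first exact: lebesgue_rV_ge0.
by apply: IH => y; exact: AB.
Qed.

Lemma lebesgue_rV0 d : lebesgue_rV (set0 : set 'rV[R]_d) = 0.
Proof.
elim: d => [|d IH] /=; first by rewrite indic0.
by rewrite -[RHS](integral0 lebesgue_measure setT); apply: eq_integral => x _.
Qed.

(** Superadditivity passes from the slices to the iterated integral for arbitrary sets, whose slice
    volumes may fail to be measurable. It suffices to bound from below the volume of a set
    containing disjoint cubes. *)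
Lemma lebesgue_rV_superadd d (A B C : set 'rV[R]_d) : A `&` B = set0 ->
  A `<=` C -> B `<=` C -> lebesgue_rV A + lebesgue_rV B <= lebesgue_rV C.
Proof.
elim: d A B C => [|d IH] A B C AB0 AC BC /=.
  rewrite -EFinD lee_fin !indicE.
  have [A0|A0] := boolP (0%R \in A); last first.
    rewrite add0r ler_nat; case: (boolP (0%R \in B)) => // /set_mem/BC.
    by move/mem_set ->.
  have -> : (0%R \in C) = true by apply/mem_set/AC/set_mem.
  have [B0|//] := boolP (0%R \in B); last by rewrite addr0.
  have : set0 (0 : 'rV[R]_0)%R by rewrite -AB0; split; exact: set_mem.
  by [].
apply: ge0_integral_superadd => x; rewrite ?lebesgue_rV_ge0//.
apply: IH => [|y|y]; [|exact: AC|exact: BC].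
rewrite -subset0 => y [Ay By].
have : set0 (row_mx x%:M y : 'rV[R]_(1 + d)) by rewrite -AB0.
by [].
Qed.

Lemma lebesgue_rV_disjoint_sum d N (F : nat -> set 'rV[R]_d) (C : set 'rV[R]_d) :
  (forall i j, (i < j < N)%N -> F i `&` F j = set0) ->
  (forall i, (i < N)%N -> F i `<=` C) ->
  \sum_(i < N) lebesgue_rV (F i) <= lebesgue_rV C.
Proof.
elim: N C => [|N IH] C Fd FC; first by rewrite big_ord0 lebesgue_rV_ge0.
rewrite big_ord_recr/=.
apply: (@le_trans _ _ (lebesgue_rV (\bigcup_(i in `I_N) F i) + lebesgue_rV (F N))).
  apply: leeD => //; apply: IH => [i j /andP[ij jN]|i iN x Fx]; last by exists i.
  by apply: Fd; rewrite ij ltnS ltnW.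
apply: lebesgue_rV_superadd; last exact: FC.
  rewrite -subset0 => x [[i /= iN Fi] FN].
  have : set0 x by rewrite -(Fd i N) ?iN ?leqnn.
  by [].
by move=> x [i /= iN]; apply: FC; rewrite ltnS ltnW.
Qed.

(** Balls of the sup norm: their iterated integral is explicit, and the volume estimates below are
    comparisons with them. *)
Definition cube d (p : 'rV[R]_d) (rho : R) : set 'rV[R]_d :=
  [set x | forall i, (`|x 0 i - p 0 i| <= rho)%R].

Let lshift0E d : lshift d (0%R : 'I_1) = (0%R : 'I_d.+1).
Proof. exact: val_inj. Qed.

Let row_mx0E d (x : R) (y : 'rV[R]_d) :
  (row_mx (x%:M : 'M[R]_1) y : 'rV[R]_d.+1) 0%R 0%R = x.
Proof. by rewrite -(lshift0E d) (row_mxEl (x%:M : 'M[R]_1) y) mxE eqxx mulr1n. Qed.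

Lemma lebesgue_rV_cube d (p : 'rV[R]_d) rho : (0 <= rho)%R ->
  lebesgue_rV (cube p rho) = ((2 * rho) ^+ d)%:E.
Proof.
move=> rho0; elim: d p => [|d IH] p /=.
  by rewrite indicE mem_set//= => -[].
pose p' : 'rV[R]_d := rsubmx (p : 'rV[R]_(1 + d)).
(* The slice at x is the cube around the remaining coordinates of p if x is within rho of the first
   one, and empty otherwise. *)
transitivity (\int[lebesgue_measure]_(x in `[(p 0 0 - rho)%R, (p 0 0 + rho)%R]) ((2 * rho) ^+ d)%:E).
  rewrite [RHS]integral_mkcond; apply: eq_integral => x _.
  rewrite patchE; case: ifPn => [/set_mem|/negP xp].
    rewrite /= in_itv/= => xp; rewrite -(IH p'); congr lebesgue_rV.
    apply/seteqP; split => y.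
      move=> Ay i; have := Ay (rshift 1 i).
      by rewrite (row_mxEr (x%:M : 'M[R]_1) y) /p' mxE.
    move=> Ay i; case: (@split_ordP 1 d i) => j ->.
      by rewrite (ord1 j) lshift0E (row_mx0E x y) ler_distl.
    by rewrite (row_mxEr (x%:M : 'M[R]_1) y); have := Ay j; rewrite /p' mxE.
  rewrite -[RHS](lebesgue_rV0 d); congr lebesgue_rV.
  rewrite -subset0 => y /(_ 0%R).
  rewrite (row_mx0E x y) => h; apply: xp; apply/mem_set.
  by rewrite /= in_itv/= -ler_distl.
rewrite integral_cst//= lebesgue_measure_itv/= lte_fin.
have [h|h] := ltP (p 0 0 - rho)%R (p 0 0 + rho)%R.
  by rewrite -EFinB -EFinM exprSr; congr (_%:E); congr (_ * _)%R; lra.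
have -> : rho = 0%R by lra.
by rewrite mulr0 expr0n mule0/= exprS mul0r.
Qed.

End lebesgue_rV_theory.

(** * Probabilities of caps *)

Section ratio.
Variable R : realType.
Local Open Scope ereal_scope.

(** By the conventions on inverses, dividing by 0 gives 0 or an infinite value and dividing by +oo
    gives 0, never 1. Applied to the total mass of a uniform law, this makes the normalising volume
    positive and finite. *)
Lemma div_eq1_fin (z y : \bar R) : 0 <= y -> z / y = 1 ->
  exists2 g : R, (0 < g)%R & y = g%:E.
Proof.
case: y => [y|_|//].
  rewrite lee_fin le_eqVlt => /predU1P[<-|y0 _]; last by exists y.
  rewrite inve0; case: z => [z| |].
  - have [->|z0] := eqVneq z 0%R; first by rewrite mul0e => -[] /esym/eqP; rewrite oner_eq0.
    by rewrite mulry; case: (sgrP z) z0 => //= _ _; rewrite ?mul1e ?mulN1e.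
  - by rewrite mulyy.
  - by rewrite mulNyy.
by rewrite invey mule0 => -[] /esym/eqP; rewrite oner_eq0.
Qed.

Lemma le_div_of_bounds (z x y : \bar R) (a B : R) : 0 <= y -> z / y = 1 ->
  (0 <= a)%R -> a%:E <= x -> y <= B%:E -> (a / B)%:E <= x / y.
Proof.
move=> y0 /(div_eq1_fin y0)[g g0 ->] a0 ax; rewrite lee_fin => gB.
rewrite inver gt_eqF// EFinM; apply: lee_pmul => //.
  by rewrite lee_fin invr_ge0 (le_trans (ltW g0)).
by rewrite lee_fin lef_pV2// posrE (lt_le_trans g0).
Qed.

End ratio.

(** * Borel sets and linear forms *)

Section borel_rV_sets.
Variables (R : realType) (d : nat).

Lemma measurable_closed_rV (A : set 'rV[R]_d) : closed A -> measurable A.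
Proof.
move=> cA; rewrite -[A]setCK; apply: measurableC.
by apply: sub_sigma_algebra; rewrite openC.
Qed.

Lemma measurable_halfspace_ge (u : 'rV[R]_d) c : measurable [set x | c <= dotp u x].
Proof.
apply: measurable_closed_rV.
rewrite (_ : [set x | _] = dotp u @^-1` [set y | c <= y])//.
by apply: preimage_closed; [move=> x _; exact: continuous_dotp|exact: closed_ge].
Qed.

Lemma measurable_eball (a : 'rV[R]_d) rho : measurable (eball a rho).
Proof. by apply: measurable_closed_rV; exact: closed_eball. Qed.

Lemma measurable_sphere : measurable [set u : 'rV[R]_d | enorm u = 1].
Proof.
apply: measurable_closed_rV.
rewrite (_ : [set x | _] = (fun x : 'rV[R]_d => enorm (x - 0)) @^-1` [set 1]).
  by apply: preimage_closed; [move=> x _; exact: continuous_enormB|exact: closed_eq].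
by apply/seteqP; split => x /=; rewrite subr0.
Qed.

Lemma measurable_compact (G : set 'rV[R]_d) : compact G -> measurable G.
Proof.
move=> cG; apply: measurable_closed_rV; exact: compact_closed.
Qed.

Lemma measurable_fun_dotp (u : 'rV[R]_d) : measurable_fun setT (dotp u).
Proof.
apply: (measurability (@RGenCInfty.G R)); first exact: RGenCInfty.measurableE.
move=> _ [_ [c ->] <-]; rewrite setTI.
rewrite (_ : _ @^-1` _ = [set x | c <= dotp u x]); first exact: measurable_halfspace_ge.
by apply/seteqP; split => x /=; rewrite in_itv/= andbT.
Qed.

End borel_rV_sets.

Lemma measurable_preimage (d1 d2 : measure_display) (T1 : measurableType d1)
  (T2 : measurableType d2) (f : {mfun T1 >-> T2}) (A : set T2) :
  measurable A -> measurable (f @^-1` A).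
Proof. by move=> mA; rewrite -[X in measurable X]setTI; exact: measurable_funPT. Qed.

Section caps.
Variables (R : realType) (d : nat) (disp : measure_display).
Variables (Omega : measurableType disp) (P : probability Omega R).
Implicit Types (X U : {RV P >-> 'rV[R]_d}) (G : set 'rV[R]_d).
Hypothesis d0 : (0 < d)%N.

Let d0R : 0 < d%:R :> R. Proof. by rewrite ltr0n. Qed.

Lemma eball_sub_cube a rho : eball a rho `<=` cube (a : 'rV[R]_d) rho.
Proof.
move=> x xa i; apply: le_trans xa; have := coord_le_enorm (x - a) i.
by rewrite !mxE.
Qed.

Lemma cube_sub_eball a rho : cube a (rho / d%:R) `<=` eball (a : 'rV[R]_d) rho.
Proof.
move=> x xa; rewrite /eball/=.
rewrite -[rho](divfK (lt0r_neq0 d0R)) mulrC; apply: enorm_le_max => i.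
by rewrite !mxE.
Qed.

Lemma lebesgue_rV_eball_le (a : 'rV[R]_d) rho : 0 <= rho ->
  (lebesgue_rV (eball a rho) <= ((2 * rho) ^+ d)%:E)%E.
Proof. by move=> r0; rewrite -(lebesgue_rV_cube a)// le_lebesgue_rV//; exact: eball_sub_cube. Qed.

Lemma distribution_setT X : distribution P X setT = 1%E.
Proof. exact: probability_setT. Qed.

Lemma uniform_on_outside X G : compact G -> uniform_on G X ->
  P (X @^-1` ~` G) = 0%E.
Proof.
move=> cG /(_ (~` G)) /=.
rewrite setICl lebesgue_rV0 mul0e; apply.
by apply: measurableC; exact: measurable_compact.
Qed.

(** The numerator is at least the volume of a cube of side 2 rho, and the denominator at most that
    of the cube of side 2 Rad around the outer ball. *)
Lemma uniform_on_ge X G A (Rad rho : R) (q : 'rV[R]_d) :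
  uniform_on G X -> measurable A -> G `<=` eball 0 Rad -> 0 < Rad -> 0 <= rho ->
  cube q rho `<=` A `&` G ->
  (((rho / Rad) ^+ d)%:E <= P (X @^-1` A))%E.
Proof.
move=> uX mA GR R0 rho0 qAG.
have e1 : (lebesgue_rV G / lebesgue_rV G = 1)%E.
  by rewrite -[RHS](distribution_setT X) uX// setTI.
have -> : (rho / Rad) ^+ d = (2 * rho) ^+ d / (2 * Rad) ^+ d.
  by rewrite -exprVn -exprMn -mulf_div divff ?mul1r// gt_eqF.
rewrite -[leRHS]/(distribution P X A) uX//.
apply: (le_div_of_bounds _ e1); first exact: lebesgue_rV_ge0.
- by rewrite exprn_ge0// mulr_ge0.
- by rewrite -(lebesgue_rV_cube q)//; exact: le_lebesgue_rV.
- apply: le_trans (lebesgue_rV_eball_le 0 (ltW R0)).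
  exact: le_lebesgue_rV.
Qed.

Lemma uniform_on_cap X G a (r Rad s : R) (v : 'rV[R]_d) :
  convex_body G -> eball a r `<=` G -> G `<=` eball 0 Rad -> 0 < r -> 0 < Rad ->
  uniform_on G X -> enorm v = 1 -> 0 <= s <= 2 * Rad ->
  (((s * r / (2 * d%:R * Rad ^+ 2)) ^+ d)%:E <=
    P (X @^-1` [set x | (suppf G v - s <= dotp v x)%R]))%E.
Proof.
move=> [vG cG _] aG GR r0 R0 uX v1 /andP[s0 sR].
have Ga : G a by apply: aG; rewrite /eball/= subrr enorm0 ltW.
have [p Gp pmax] := suppf_attained v cG (ex_intro _ a Ga).
rewrite (suppf_max Gp pmax).
pose tau := s / (2 * Rad).
have tau01 : 0 <= tau <= 1.
  by rewrite divr_ge0 ?mulr_ge0 ?(ltW R0)//= ler_pdivrMr ?mul1r ?mulr_gt0.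
have -> : s * r / (2 * d%:R * Rad ^+ 2) = (tau * r / d%:R) / Rad.
  by rewrite /tau; field; rewrite !gt_eqF.
(* The cap contains the image of the inner ball under the homothety of centre p
   and ratio tau. *)
apply: (uniform_on_ge uX _ GR R0 (q := p + tau *: (a - p))).
- exact: measurable_halfspace_ge.
- case/andP: tau01 => t0 _.
  by rewrite divr_ge0//; exact: mulr_ge0 t0 (ltW r0).
move=> x /cube_sub_eball; rewrite /eball/= => xq.
(* Undo the homothety; for tau = 0 the point x is p itself and any y serves. *)
have [y ay ->] : exists2 y, eball a r y & x = p + tau *: (y - p).
  have [t0|t0] := eqVneq tau 0.
    exists a; first by rewrite /eball/= subrr enorm0 ltW.
    move: xq; rewrite t0 !scale0r !addr0 mul0r => xp.
    by apply/eqP; rewrite -subr_eq0 -enorm_eq0 eq_le xp enorm_ge0.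
  have tp : 0 < tau by case/andP: tau01 => + _; rewrite le_eqVlt eq_sym (negbTE t0).
  exists (p + tau^-1 *: (x - p)).
    rewrite /eball/= -(ler_pM2l tp) -[X in X * _](ger0_norm (ltW tp)) -enormZ.
    rewrite scalerBr scalerDr scalerA divff// scale1r.
    apply: le_trans xq; rewrite le_eqVlt; apply/orP; left; apply/eqP; congr enorm.
    by apply/rowP => i; rewrite !mxE; ring.
  by rewrite addrAC subrr add0r scalerA divff// scale1r subrKC.
have Gy := aG _ ay.
split; last exact: convex_segment.
rewrite /= dotpDr dotpZr lerD2l.
(* The homothety multiplies this height difference by tau = s / (2 Rad), so the height lost is at
   most s. *)
have : - (2 * Rad) <= dotp v (y - p).
  have := abs_dotp_le v (y - p); rewrite v1 mul1r ler_norml => /andP[+ _].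
  apply: le_trans; rewrite lerN2; apply: le_trans (ler_enormB _ _) _.
  have := GR _ Gy; have := GR _ Gp; rewrite /eball/= !subr0; lra.
case/andP: tau01 => t0 _; move/(ler_wpM2l t0); apply: le_trans.
by rewrite mulrN divfK// gt_eqF// mulr_gt0.
Qed.

Lemma uniform_on_sphere_norm U : uniform_on_sphere U ->
  P (U @^-1` ~` [set u | enorm u = 1]) = 0%E.
Proof.
move=> uU.
rewrite -[LHS]/(distribution P U (~` [set u | enorm u = 1])) uU; last first.
  by apply: measurableC; exact: measurable_sphere.
rewrite (_ : [set x | _] = set0) ?lebesgue_rV0 ?mul0e//.
rewrite -subset0 => x [/andP[x0 _]]; apply => /=.
by rewrite enorm_normalize// -enorm_gt0.
Qed.

(** Otherwise the sum of the |v_i|, which bounds |v| = 1, would be below 1. Such a coordinate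
    separates the cubes stacked along v in the next estimate. *)
Lemma enorm1_coord_ge (v : 'rV[R]_d) : enorm v = 1 -> exists i, d%:R^-1 <= `|v 0 i|.
Proof.
move=> v1; apply: contrapT => /forallNP h.
have : \sum_(i < d) `|v 0 i| < \sum_(i < d) d%:R^-1.
  apply: ltr_sum; first by apply/hasP; exists (Ordinal d0) => //; rewrite mem_index_enum.
  by move=> i _; rewrite ltNge; apply/negP/h.
rewrite sumr_const card_ord -[_ *+ _]mulr_natl divff ?gt_eqF//.
by rewrite ltNge -[X in X <= _]v1 enorm_le_sum.
Qed.

Lemma uniform_on_sphere_cap U (v : 'rV[R]_d) (delta : R) :
  uniform_on_sphere U -> enorm v = 1 -> 0 < delta <= 1 ->
  (((delta / (4 * d%:R)) ^+ d.-1 / (6 * d%:R * 2 ^+ d))%:E <=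
    P (U @^-1` eball v delta))%E.
Proof.
move=> uU v1 /andP[dl0 dl1].
have e1 := uU setT measurableT; rewrite distribution_setT in e1.
rewrite -[leRHS]/(distribution P U (eball v delta)) uU; last exact: measurable_eball.
(* The half-side delta/(8d) puts each cube in a ball of radius delta/8. Consecutive centres are h =
   3 delta/8 apart, hence differ by at least 3 delta/(8d) > 2 rho in a large coordinate of v. *)
have [rho rhoE] : {rho | rho = delta / (8 * d%:R)} by exists (delta / (8 * d%:R)).
have rho0 : 0 < rho by rewrite rhoE divr_gt0 ?mulr_gt0.
have drho : rho = (delta / 8) / d%:R by rewrite rhoE invfM mulrA.
have [h hE] : {h | h = 3 / 8 * delta} by exists (3 / 8 * delta).
have h0 : 0 < h by rewrite hE mulr_gt0.
pose N := Num.truncn (1 / (2 * h)).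
have Nle : N%:R * h <= 1 / 2.
  have : N%:R <= 1 / (2 * h) by rewrite /N truncn_le divr_ge0 ?mulr_ge0 ?(ltW h0).
  by rewrite ler_pdivlMr ?mulr_gt0//; lra.
(* Since N >= 1, N is at least half of N + 1, which exceeds 1/(2h) = 4/(3 delta). *)
have Nge : 2 / (3 * delta) <= N%:R.
  have := truncnS_gt (1 / (2 * h)); rewrite -/N -natr1.
  have -> : 1 / (2 * h) = 2 * (2 / (3 * delta)) by rewrite hE; field; rewrite gt_eqF.
  have N1 : 1 <= N%:R :> R.
    rewrite ler1n /N truncn_ge_nat ?divr_ge0 ?mulr_ge0 ?(ltW h0)//.
    by rewrite ler_pdivlMr ?mulr_gt0// hE; lra.
  by lra.
(* The truncated cone over the cap contains about 1/delta disjoint cubes of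
   side of order delta, centred on the segment from v/4 to 3v/4. *)
pose F i : set 'rV[R]_d := cube ((1 / 4 + i%:R * h) *: v) rho.
have [k vk] := enorm1_coord_ge v1.
have -> : (delta / (4 * d%:R)) ^+ d.-1 / (6 * d%:R * 2 ^+ d) =
   (2 / (3 * delta) * (2 * rho) ^+ d) / (2 * 1) ^+ d.
  have -> : 2 * rho = delta / (4 * d%:R) by rewrite rhoE; field; rewrite gt_eqF.
  rewrite mulr1 -[in X in _ * _ ^+ X / _](prednK d0) exprSr.
  have := exprn_gt0 d (ltr0n R 2); set Z := 2 ^+ d => Z0.
  by field; rewrite !gt_eqF.
apply: (le_div_of_bounds _ (esym e1)); first exact: lebesgue_rV_ge0.
- by rewrite mulr_ge0 ?divr_ge0 ?exprn_ge0 ?mulr_ge0 ?(ltW rho0) ?(ltW dl0).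
- apply: (@le_trans _ _ (\sum_(i < N) lebesgue_rV (F i))%E).
    under eq_bigr do rewrite lebesgue_rV_cube ?(ltW rho0)//.
    rewrite sumEFin sumr_const card_ord lee_fin -[leRHS]mulr_natl.
    by rewrite ler_wpM2r// exprn_ge0// mulr_ge0 ?ltW.
  apply: lebesgue_rV_disjoint_sum => [i j /andP[ij _]|i iN x].
    rewrite -subset0 => x [/(_ k) xi /(_ k) xj]; rewrite !mxE in xi xj.
    have : `|(j%:R - i%:R) * h * v 0 k| <= 2 * rho.
      have -> : (j%:R - i%:R) * h * v 0 k =
         (x 0 k - (1 / 4 + i%:R * h) * v 0 k) - (x 0 k - (1 / 4 + j%:R * h) * v 0 k).
        by ring.
      by apply: le_trans (ler_normB _ _) _; rewrite [leRHS](mulr_natl rho 2) mulr2n lerD.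
    rewrite normrM ger0_norm; last first.
      by rewrite mulr_ge0 ?(ltW h0)// subr_ge0 ler_nat ltnW.
    have ji : 1 <= j%:R - i%:R :> R by rewrite lerBrDl natr1 ler_nat.
    have : h * d%:R^-1 <= (j%:R - i%:R) * h * `|v 0 k|.
      rewrite ler_pM ?(ltW h0) ?invr_ge0 ?ler0n//.
      by rewrite ler_peMl ?(ltW h0).
    move=> /le_trans/[apply].
    rewrite drho mulrA ler_pM2r ?invr_gt0// hE.
    by lra.
  rewrite /F drho => /cube_sub_eball; rewrite /eball/=.
  set t := 1 / 4 + _ => xt.
  have t1 : 1 / 4 <= t by rewrite lerDl mulr_ge0 ?(ltW h0).
  have t2 : t <= 3 / 4.
    have : i%:R * h <= N%:R * h by rewrite ler_pM2r// ler_nat ltnW.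
    by rewrite /t; lra.
  have t0 : 0 < t by lra.
  have nt : enorm (t *: v) = t by rewrite enormZ v1 mulr1 ger0_norm// ltW.
  have lb : t - delta / 8 <= enorm x.
    have := ler_enormD (t *: v - x) x; rewrite subrK nt enormB; lra.
  have ub : enorm x <= t + delta / 8.
    have := ler_enormD (x - t *: v) (t *: v); rewrite subrK nt; lra.
  have x0 : 0 < enorm x by lra.
  split; first by apply/andP; split; lra.
  rewrite -(ler_pM2l t0) -[X in X * _](ger0_norm (ltW t0)) -enormZ.
  (* Each of the two terms has norm at most delta/8, and delta/4 <= t delta because t >= 1/4. *)
  have -> : t *: ((enorm x)^-1 *: x - v) =
      (t - enorm x) *: ((enorm x)^-1 *: x) + (x - t *: v).
    rewrite scalerBr scalerBl scalerA.
    by rewrite (scalerA (enorm x)) divff ?gt_eqF// scale1r addrA subrK.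
  apply: le_trans (ler_enormD _ _) _.
  rewrite enormZ enorm_normalize ?mulr1 -?enorm_gt0//.
  have : `|t - enorm x| <= delta / 8 by rewrite ler_norml; lra.
  by nra.
- by have := lebesgue_rV_eball_le 0 ler01.
Qed.

End caps.

(** * Gaussian tails *)

Section gaussian_tails.
Variable R : realType.
Variable sigma : R.
Hypothesis sigma0 : 0 < sigma.
Local Open Scope ereal_scope.

Let sigma_neq0 : sigma != 0%R. Proof. by rewrite gt_eqF. Qed.

Let mpdf m (D : set R) : measurable_fun D (fun x => (normal_pdf m sigma x)%:E).
Proof.
by apply/measurable_EFinP; apply: measurable_funTS; exact: measurable_normal_pdf.
Qed.

(* On [t, +oo[ the density of N(0, sigma^2) is at most exp(- t^2 / (2 sigma^2))
   times that of N(t, sigma^2). *)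
Lemma normal_tail_le (t : R) : (0 <= t)%R ->
  normal_prob 0 sigma `[t, +oo[ <= (expR (- t ^+ 2 / (2 * sigma ^+ 2)))%:E.
Proof.
move=> t0; set c := expR _.
apply: (@le_trans _ _ (c%:E * normal_prob t sigma `[t, +oo[)); last first.
  rewrite -[leRHS]mule1; apply: lee_wpmul2l; first by rewrite lee_fin expR_ge0.
  exact: probability_le1.
rewrite /normal_prob -ge0_integralZl//=; last 3 first.
- exact: mpdf.
- by move=> x _; rewrite lee_fin normal_pdf_ge0.
- by rewrite lee_fin expR_ge0.
apply: ge0_le_integral => //=.
- by move=> x _; rewrite lee_fin normal_pdf_ge0.
- exact: mpdf.
- apply/measurable_EFinP/measurable_funM => //.
  by apply: measurable_funTS; exact: measurable_normal_pdf.
move=> x; rewrite /= in_itv/= andbT => tx.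
rewrite lee_fin !normal_pdfE// mulrCA ler_wpM2l ?normal_peak_ge0//.
rewrite /normal_fun /c -expRD ler_expR subr0.
have s0 : (0 < sigma ^+ 2)%R by rewrite exprn_gt0.
have -> : (- t ^+ 2 / (2 * sigma ^+ 2) + - (x - t) ^+ 2 / (sigma ^+ 2 *+ 2) =
  - x ^+ 2 / (sigma ^+ 2 *+ 2) + t * (x - t) / sigma ^+ 2)%R.
  rewrite -[(_ *+ 2)%R]mulr_natl; field; by rewrite gt_eqF.
by rewrite lerDl divr_ge0 ?(ltW s0)// mulr_ge0// subr_ge0.
Qed.

(** On [x, x + eta] the density is at least its value at the right end. *)
Lemma normal_tail_ge (x eta : R) : (0 <= x)%R -> (0 <= eta)%R ->
  (eta * normal_peak sigma * expR (- (x + eta) ^+ 2 / (2 * sigma ^+ 2)))%:E <=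
  normal_prob 0 sigma `[x, +oo[.
Proof.
move=> x0 eta0; rewrite -mulrA mulrC EFinM.
set c := (_ * expR _)%R.
have -> : eta%:E = lebesgue_measure `[x, (x + eta)%R].
  rewrite lebesgue_measure_itv/= lte_fin ltrDl.
  move: eta0; rewrite le_eqVlt => /predU1P[<-|->]; first by rewrite ltxx.
  by rewrite -EFinB addrC addKr.
rewrite -integral_cst//= /normal_prob.
apply: (@le_trans _ _ (\int[lebesgue_measure]_(y in `[x, (x + eta)%R]) (normal_pdf 0 sigma y)%:E)).
  apply: ge0_le_integral => //=.
  - by move=> y _; rewrite lee_fin mulr_ge0 ?normal_peak_ge0 ?expR_ge0.
  - exact: mpdf.
  move=> y; rewrite /= in_itv/= => /andP[xy yx].
  rewrite lee_fin normal_pdfE// ler_wpM2l ?normal_peak_ge0// ler_expR subr0.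
  rewrite -[(sigma ^+ 2 *+ 2)%R]mulr_natl !mulNr lerN2 ler_wpM2r//.
    by rewrite invr_ge0 mulr_ge0// sqr_ge0.
  by rewrite ler_pXn2r// nnegrE ?addr_ge0// (le_trans x0).
apply: ge0_subset_integral => //=.
- exact: mpdf.
- by move=> y _; rewrite lee_fin normal_pdf_ge0.
- by move=> y; rewrite /= !in_itv/= andbT => /andP[].
Qed.

Variables (d : nat) (disp : measure_display).
Variables (Omega : measurableType disp) (P : probability Omega R).
Variable Z : {RV P >-> 'rV[R]_d}.
Hypothesis gZ : isotropic_gaussian sigma Z.

Lemma isotropic_gaussian_itv (v : 'rV[R]_d) (t : R) : enorm v = 1%R ->
  P [set w | (t <= dotp v (Z w))%R] = normal_prob 0 sigma `[t, +oo[.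
Proof.
move=> v1; have v0 : v != 0%R by rewrite -enorm_eq0 v1 oner_eq0.
rewrite -[sigma in RHS]mulr1 -v1 -gZ//; congr (P _).
by apply/seteqP; split => w /=; rewrite in_itv/= andbT.
Qed.

Lemma isotropic_gaussian_tail_le (v : 'rV[R]_d) (t : R) : enorm v = 1%R ->
  (0 <= t)%R ->
  P [set w | (t <= dotp v (Z w))%R] <= (expR (- t ^+ 2 / (2 * sigma ^+ 2)))%:E.
Proof. by move=> v1 t0; rewrite isotropic_gaussian_itv//; exact: normal_tail_le. Qed.

(** Integrating P(<v,Z>^2 > r) over r >= 0, the two one-sided tails add up to 2 exp(- r / (2
    sigma^2)), which is 4 sigma^2 times an exponential density of rate 1 / (2 sigma^2). *)
Lemma isotropic_gaussian_second_moment (v : 'rV[R]_d) : enorm v = 1%R ->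
  \int[P]_w (dotp v (Z w) ^+ 2)%:E <= (4 * sigma ^+ 2)%:E.
Proof.
move=> v1.
have mf : measurable_fun setT (fun w => (dotp v (Z w) ^+ 2)%R).
  apply: measurable_funX; apply: measurableT_comp; first exact: measurable_fun_dotp.
  exact: measurable_funPT.
have mH u t : measurable [set w | (t <= dotp u (Z w))%R].
  exact: (measurable_preimage Z (measurable_halfspace_ge u t)).
pose X : {RV P >-> R} := mfun_Sub (mem_set mf).
rewrite -[leLHS]/(\int[P]_w (X w)%:E) -expectation_def.
rewrite ge0_expectation_ccdf; last by move=> w; exact: sqr_ge0.
pose rate : R := ((2 * sigma ^+ 2)^-1)%R.
have rate0 : (0 < rate)%R by rewrite invr_gt0 mulr_gt0// exprn_gt0.
apply: (@le_trans _ _ (\int[lebesgue_measure]_r ((4 * sigma ^+ 2)%:E * (exponential_pdf rate r)%:E))).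
  rewrite integral_mkcond; apply: ge0_le_integral_nomeas => r.
    by rewrite patchE; case: ifP.
  rewrite patchE; case: ifPn => [/set_mem|_]; last first.
    by apply: mule_ge0; rewrite lee_fin ?exponential_pdf_ge0 ?(ltW rate0)// mulr_ge0 ?sqr_ge0.
  rewrite /= in_itv/= andbT => r0.
  rewrite /exponential_pdf patchE mem_set/=; last by rewrite in_itv/= r0.
  have sr : (Num.sqrt r ^+ 2 = r)%R by rewrite sqr_sqrtr.
  have vN1 : enorm (- v) = 1%R by rewrite enormN.
  apply: (@le_trans _ _ (P ([set w | (Num.sqrt r <= dotp v (Z w))%R] `|`
                             [set w | (Num.sqrt r <= dotp (- v) (Z w))%R]))).
    rewrite /ccdf /distribution /pushforward; apply: le_measure; rewrite ?inE.
    - exact: (measurable_preimage X).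
    - exact: measurableU.
    - move=> w /=; rewrite in_itv/= andbT /X/= -{1}sr => /ltW.
      rewrite -[leRHS]real_normK ?num_real// ler_sqr ?nnegrE ?sqrtr_ge0//.
      rewrite ler_normr dotpC (dotpC (- v)) dotpNr => /orP[]; by [left|right].
  apply: (le_trans (measureU2 _ _ _)) => //.
  apply: (@le_trans _ _ ((expR (- r / (2 * sigma ^+ 2)))%:E + (expR (- r / (2 * sigma ^+ 2)))%:E)).
    have tl u (u1 : enorm u = 1%R) := isotropic_gaussian_tail_le u1 (sqrtr_ge0 r).
    by apply: leeD; rewrite -[in leRHS]sr; exact: tl.
  rewrite -EFinD -EFinM lee_fin [leRHS]mulrA.
  have -> : (4 * sigma ^+ 2 * rate = 2)%R by rewrite /rate; field; rewrite gt_eqF.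
  by rewrite [leRHS]mulr_natl mulr2n /rate !mulNr (mulrC r).
rewrite ge0_integralZl//=.
- by rewrite integral_exponential_pdf// mule1.
- by apply/measurable_EFinP; exact: measurable_exponential_pdf.
- by move=> x _; rewrite lee_fin exponential_pdf_ge0// ltW.
- by rewrite lee_fin mulr_ge0// sqr_ge0.
Qed.

End gaussian_tails.

(** * Independence *)

Section finite_events.
Variables (R : realType) (disp : measure_display).
Variables (Omega : measurableType disp) (P : probability Omega R).
Variable I : finType.
Implicit Types D F : I -> set Omega.

Lemma probability_bigsetU_le F : (forall i, measurable (F i)) ->
  measurable (\big[setU/set0]_i F i) /\
  (P (\big[setU/set0]_i F i) <= \sum_i P (F i))%E.
Proof.
move=> mF; elim/big_ind2 : _ => [|x y A B [mA PA] [mB PB]|i _]; last by [].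
- by rewrite measure0.
- by split; [exact: measurableU|exact: le_trans (measureU2 _ mA mB) (leeD PA PB)].
Qed.

Lemma subset_bigsetU F i : F i `<=` \big[setU/set0]_i F i.
Proof. by rewrite (bigD1 i)//= => w; left. Qed.

Let meas_bigcap D (A : set I) : (forall i, measurable (D i)) ->
  measurable (\bigcap_(i in A) D i).
Proof.
by move=> mD; apply: fin_bigcap_measurable => //; exact: finite_finset.
Qed.

Lemma probability_bigcap_compl D (p : I -> R) : (forall i, measurable (D i)) ->
  (forall S : {set I},
     P (\bigcap_(i in [set i | i \in S]) D i) = (\prod_(i in S) p i)%:E) ->
  P (\bigcap_(i in [set: I]) ~` D i) = (\prod_i (1 - p i))%:E.
Proof.
move=> mD PD.
(* Complement the events one at a time: the elements of s have been
   complemented, those of S have not. *)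
have key (s : seq I) (S : {set I}) : uniq s -> (forall i, i \in s -> i \notin S) ->
    P ((\bigcap_(i in [set i | i \in S]) D i) `&`
       (\bigcap_(i in [set i | i \in s]) ~` D i)) =
    (\prod_(i in S) p i * \prod_(i <- s) (1 - p i))%:E.
  elim: s S => [|j s IH] S; rewrite ?cons_uniq.
    move=> _ _; rewrite big_nil mulr1 -PD; congr (P _).
    by apply/seteqP; split => w /=; [case|split].
  move=> /andP[js us] sS; set A := \bigcap_(i in _) D i.
  set B := \bigcap_(i in [set i | i \in s]) ~` D i.
  have mA : measurable A by exact: meas_bigcap.
  have mB : measurable B by apply: meas_bigcap => i; exact: measurableC.
  have -> : A `&` (\bigcap_(i in [set i | i \in j :: s]) ~` D i) = (A `&` B) `\` D j.
    apply/seteqP; split => w.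
      move=> [Aw Bw]; split; [split => // i /= is_|].
        by apply: Bw; rewrite /= inE is_ orbT.
      by apply: Bw; rewrite /= inE eqxx.
    move=> [[Aw Bw] Dj]; split => // i /=; rewrite inE => /predU1P[->//|is_].
    exact: Bw.
  have mAB : measurable (A `&` B) by exact: measurableI.
  rewrite measureD//; last by rewrite ltey_eq fin_num_measure.
  have -> : A `&` B `&` D j = (\bigcap_(i in [set i | i \in j |: S]) D i) `&` B.
    apply/seteqP; split => w.
      move=> [[Aw Bw] Dj]; split => // i /=; rewrite in_setU1 => /predU1P[->//|iS].
      exact: Aw.
    move=> [Aw Bw]; split; [split=> // i /= iS|].
      by apply: Aw; rewrite /= in_setU1 iS orbT.
    by apply: Aw; rewrite /= in_setU1 eqxx.
  transitivity ((\prod_(i in S) p i * \prod_(i <- s) (1 - p i))%:E -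
    (\prod_(i in j |: S) p i * \prod_(i <- s) (1 - p i))%:E)%E.
    congr (_ - _)%E; apply: IH => // i is_.
      by rewrite sS// inE is_ orbT.
    rewrite in_setU1 negb_or sS ?inE ?is_ ?orbT// andbT.
    by apply: contraNneq js => <-.
  rewrite -EFinB big_cons big_setU1 ?sS ?inE ?eqxx//=; congr (_%:E); ring.
have := key (enum I) finset.set0 (enum_uniq I).
rewrite big_set0 mul1r big_enum/= => <-; last by move=> i; rewrite inE.
congr (P _); apply/seteqP; split => w.
  by move=> h; split => [i|i _]; [rewrite /= inE|exact: h].
by move=> [_ h] i _; apply: h; rewrite /= mem_enum.
Qed.

Lemma prod_1B_le (p : I -> R) (q : R) : (forall i, q <= p i <= 1) ->
  \prod_i (1 - p i) <= expR (- (#|I|%:R * q)).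
Proof.
move=> pq; apply: (@le_trans _ _ (\prod_(i : I) expR (- q))).
  apply: ler_prod => i _; have /andP[qp p1] := pq i.
  by rewrite subr_ge0 p1/= (le_trans _ (expR_ge1Dx _))// lerD2l lerN2.
by rewrite prodr_const -expRM_natl mulrN.
Qed.

End finite_events.

Section model.
Variables (R : realType) (d n M : nat) (disp : measure_display).
Variables (Omega : measurableType disp) (P : probability Omega R).
Variables (X eps : 'I_n -> {RV P >-> 'rV[R]_d}) (U : 'I_M -> {RV P >-> 'rV[R]_d}).
Let Z := (fun i : 'I_n + 'I_n + 'I_M =>
        match i with
        | inl (inl j) => X j
        | inl (inr j) => eps j
        | inr k => U k
        end).
Hypothesis indep : mutually_independent Z.

Let prodE (I : finType) (F : I -> R) :
  (\prod_i (F i)%:E)%E = (\prod_i F i)%:E.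
Proof. by elim/big_ind2 : _ => // x y a b -> ->; rewrite EFinM. Qed.

Let PE (V : {RV P >-> 'rV[R]_d}) A : measurable A ->
  P (V @^-1` A) = (fine (P (V @^-1` A)))%:E.
Proof.
by move=> mA; rewrite fineK// fin_num_measure//; exact: measurable_preimage.
Qed.

Let P1 (V : {RV P >-> 'rV[R]_d}) : fine (P (V @^-1` setT)) = 1.
Proof. by rewrite preimage_setT probability_setT. Qed.

Let indepE A : (forall i, measurable (A i)) ->
  P (\bigcap_(i in [set: 'I_n + 'I_n + 'I_M]) (Z i @^-1` A i)) =
  ((\prod_j fine (P (X j @^-1` A (inl (inl j)))) *
    \prod_j fine (P (eps j @^-1` A (inl (inr j))))) *
    \prod_k fine (P (U k @^-1` A (inr k))))%:E.
Proof.
move=> mA; rewrite indep//.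
rewrite (eq_bigr (fun i => (fine (P (Z i @^-1` A i)))%:E)); last first.
  by move=> i _; exact: PE.
by rewrite prodE !big_sumType.
Qed.

Lemma prob_no_direction_in (A : set 'rV[R]_d) (q : R) : measurable A ->
  (forall k, (q%:E <= P (U k @^-1` A))%E) ->
  (P (\bigcap_(k in [set: 'I_M]) ~` (U k @^-1` A)) <= (expR (- (M%:R * q)))%:E)%E.
Proof.
move=> mA qP.
pose B (i : 'I_n + 'I_n + 'I_M) := if i is inr k then ~` A else setT.
have mB i : measurable (B i) by case: i => [i|k] //=; exact: measurableC.
have -> : \bigcap_(k in [set: 'I_M]) ~` (U k @^-1` A) =
    \bigcap_(i in [set: 'I_n + 'I_n + 'I_M]) (Z i @^-1` B i).
  apply/seteqP; split => w h.
    by move=> [[j|j]|k] _ //=; exact: h.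
  by move=> k _; exact: (h (inr k)).
rewrite indepE//= lee_fin.
rewrite [X in X * _ * _]big1 ?mul1r; last by move=> j _; exact: P1.
rewrite [X in X * _]big1 ?mul1r; last by move=> j _; exact: P1.
rewrite (eq_bigr (fun k => 1 - fine (P (U k @^-1` A)))); last first.
  move=> k _; rewrite preimage_setC probability_setC; last exact: measurable_preimage.
  by rewrite PE// -EFinB.
rewrite -[M in leRHS]card_ord; apply: prod_1B_le => k.
rewrite -!lee_fin -PE// qP/=; apply: probability_le1; exact: measurable_preimage.
Qed.

(** Each success involves two of the variables, so its complement is not a preimage under a single
    one. The product rule is first obtained for intersections of successes, by putting [setT] at the
    other indices, and then carried over to complements. *)
Lemma prob_no_joint_success (A B : set 'rV[R]_d) (p q : R) :
  measurable A -> measurable B -> 0 <= p -> 0 <= q ->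
  (forall j, (p%:E <= P (X j @^-1` A))%E) ->
  (forall j, (q%:E <= P (eps j @^-1` B))%E) ->
  (P (\bigcap_(j in [set: 'I_n]) ~` (X j @^-1` A `&` eps j @^-1` B))
    <= (expR (- (n%:R * (p * q))))%:E)%E.
Proof.
move=> mA mB p0 q0 pX qe.
pose pr j := fine (P (X j @^-1` A)) * fine (P (eps j @^-1` B)).
rewrite (probability_bigcap_compl (p := pr)).
- rewrite lee_fin -[n in leRHS]card_ord; apply: prod_1B_le => j.
  have pj : p <= fine (P (X j @^-1` A)) by rewrite -lee_fin -PE.
  have qj : q <= fine (P (eps j @^-1` B)) by rewrite -lee_fin -PE.
  rewrite /pr ler_pM//= mulr_ile1 ?fine_ge0//.
    by rewrite -lee_fin -PE//; apply: probability_le1; exact: measurable_preimage.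
  by rewrite -lee_fin -PE//; apply: probability_le1; exact: measurable_preimage.
- by move=> j; apply: measurableI; exact: measurable_preimage.
move=> S.
pose C (i : 'I_n + 'I_n + 'I_M) := match i with
  | inl (inl j) => if j \in S then A else setT
  | inl (inr j) => if j \in S then B else setT
  | inr k => setT end.
have mC i : measurable (C i) by case: i => [[j|j]|k] //=; case: ifP.
have -> : \bigcap_(i in [set i | i \in S]) (X i @^-1` A `&` eps i @^-1` B) =
    \bigcap_(i in [set: 'I_n + 'I_n + 'I_M]) (Z i @^-1` C i).
  apply/seteqP; split => w h.
    move=> [[j|j]|k] _ //=; case: ifPn => // jS; by have [] := h j jS.
  move=> j /= jS; have := h (inl (inl j)) I; have := h (inl (inr j)) I.
  by rewrite /= jS.
rewrite indepE//; congr (_%:E).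
rewrite [X in _ * X]big1 ?mulr1; last by move=> k _; exact: P1.
rewrite -big_split/= [RHS]big_mkcond/=; apply: eq_bigr => j _.
by case: ifP => // _; rewrite !P1 mulr1.
Qed.

End model.

(** * Nets and the good event *)

Section sphere_net.
Variables (R : realType) (d : nat).
Hypothesis d0 : (0 < d)%N.

Lemma dotp_delta (i : 'I_d) (x : 'rV[R]_d) : dotp (delta_mx 0 i) x = x 0 i.
Proof.
rewrite /dotp (bigD1 i)//= mxE !eqxx mul1r big1 ?addr0// => j ji.
by rewrite mxE (negbTE ji) mul0r.
Qed.

Lemma enorm_delta (i : 'I_d) : enorm (delta_mx 0 i : 'rV[R]_d) = 1.
Proof. by rewrite /enorm dotp_delta mxE !eqxx sqrtr1. Qed.

(* The sphere is cut into the cells of a grid of step 1/m; one point is picked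
   in each nonempty cell. *)
Lemma sphere_net (m : nat) : (0 < m)%N ->
  exists (I : finType) (c : I -> 'rV[R]_d),
    [/\ #|I| = ((2 * m).+1 ^ d)%N, forall i, enorm (c i) = 1 &
      forall u, enorm u = 1 -> exists i, enorm (u - c i) <= d%:R / m%:R].
Proof.
move=> m0; have m0R : 0 < m%:R :> R by rewrite ltr0n.
(* Coordinates of unit vectors lie in [-1,1]; shifted by 1 and scaled by m they have truncations in
   0, ..., 2m. *)
pose tr (u : 'rV[R]_d) i := Num.truncn ((u 0 i + 1) * m%:R).
pose cell (u : 'rV[R]_d) : {ffun 'I_d -> 'I_(2 * m).+1} := [ffun i => inord (tr u i)].
(* An empty cell gets a basis vector, so that every net point is a unit vector. *)
pose c f : 'rV[R]_d :=
  xget (delta_mx 0 (Ordinal d0)) [set u | enorm u = 1 /\ cell u = f].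
have cP f : enorm (c f) = 1.
  by rewrite /c; case: xgetP => [u _ []//|_]; exact: enorm_delta.
have pos (u : 'rV[R]_d) i : enorm u = 1 -> 0 <= (u 0 i + 1) * m%:R.
  move=> u1; rewrite mulr_ge0 ?ler0n//.
  by have := coord_le_enorm u i; rewrite u1 ler_norml; lra.
have trlt (u : 'rV[R]_d) i : enorm u = 1 -> (tr u i < (2 * m).+1)%N.
  move=> u1; rewrite ltnS -(ler_nat R); apply: (@le_trans _ _ ((u 0 i + 1) * m%:R)).
    by rewrite /tr truncn_le pos.
  rewrite natrM ler_wpM2r ?ler0n//.
  by have := coord_le_enorm u i; rewrite u1 ler_norml; lra.
exists {ffun 'I_d -> 'I_(2 * m).+1}, c; split => //.
  by rewrite card_ffun !card_ord.
move=> u u1; exists (cell u).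
have [c1 cc] : enorm (c (cell u)) = 1 /\ cell (c (cell u)) = cell u.
  by apply: (@xgetPex _ _ [set v | enorm v = 1 /\ cell v = cell u]); exists u.
apply: enorm_le_max => i; rewrite !mxE.
have tE : tr (c (cell u)) i = tr u i.
  have := congr1 (fun f : {ffun 'I_d -> 'I_(2 * m).+1} => val (f i)) cc.
  by rewrite !ffunE /= !inordK ?trlt.
rewrite -(ler_pM2r m0R) mulVf ?gt_eqF//.
rewrite -[X in _ * X <= _](ger0_norm (ltW m0R)) -normrM mulrBl ler_norml.
have := truncn_le ((u 0 i + 1) * m%:R); rewrite pos//.
have := truncnS_gt ((u 0 i + 1) * m%:R).
have := truncn_le ((c (cell u) 0 i + 1) * m%:R); rewrite pos//.
have := truncnS_gt ((c (cell u) 0 i + 1) * m%:R).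
rewrite -/(tr u i) -/(tr (c (cell u)) i) tE -natr1.
lra.
Qed.

End sphere_net.

Section good_event.
Variables (R : realType) (d n M : nat).
Variables (x e : 'I_n -> 'rV[R]_d) (U : 'I_M -> 'rV[R]_d).
Variables (G : set 'rV[R]_d) (a : 'rV[R]_d) (r rho b t s delta mesh : R).
Variables (I : Type) (c : I -> 'rV[R]_d).
Let Y j := x j + e j.
(** [L] bounds the norms of the observations, hence the Lipschitz constant of the support estimator;
    [rho] does so for the support function of G. Passing from the net to the sphere therefore costs
    [mesh * (rho + L)]. *)
Let L := rho + 2 * (b + t).
Let eta := t + s + mesh * (rho + L).
Hypothesis n0 : (0 < n)%N.
Hypothesis bodyG : convex_body G.
Hypothesis aG : eball a r `<=` G.
Hypothesis GR : G `<=` eball 0 rho.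
Hypothesis c1 : forall i, enorm (c i) = 1.
Hypothesis net : forall u, enorm u = 1 -> exists i, enorm (u - c i) <= mesh.
Hypothesis xG : forall j, G (x j).
Hypothesis e_ub : forall i j, dotp (c i) (e j) <= b + t.
Hypothesis e_lb : forall i, exists2 j,
  suppf G (c i) - s <= dotp (c i) (x j) & b - t <= dotp (c i) (e j).
Hypotheses (mesh0 : 0 <= mesh) (mesh1 : mesh <= 2^-1) (bt0 : 0 <= b + t) (s0 : 0 <= s).
Hypothesis r0 : 0 < r.

Let G0 : G !=set0.
Proof. by exists a; apply: aG; rewrite /eball/= subrr enorm0 ltW. Qed.

Let cG : compact G. Proof. by case: bodyG. Qed.

Let x_le j : enorm (x j) <= rho.
Proof. by have := GR (xG j); rewrite /eball/= subr0. Qed.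

(** Take the net point closest to the direction of the noise e: since the mesh is at most 1/2, |e|
    <= (b + t) + |e|/2. *)
Lemma noise_norm_le j : enorm (e j) <= 2 * (b + t).
Proof.
have [->|e0] := eqVneq (e j) 0; first by rewrite enorm0 mulr_ge0.
have [i ui] := net (enorm_normalize e0).
have E0 : 0 < enorm (e j) by rewrite enorm_gt0.
set u := (enorm (e j))^-1 *: e j in ui.
have ue : dotp u (e j) = enorm (e j).
  by rewrite /u dotpZl -enorm_sqr expr2 mulrA mulVf ?mul1r// gt_eqF.
have : dotp (u - c i) (e j) <= mesh * enorm (e j).
  by apply: le_trans (cauchy_schwarz _ _) _; rewrite ler_pM2r.
have := ler_wpM2r (ltW E0) mesh1.
by rewrite dotpBl ue; have := e_ub i j; lra.
Qed.

Lemma obs_norm_le j : enorm (Y j) <= L.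
Proof. by apply: le_trans (ler_enormD _ _) _; rewrite lerD// noise_norm_le. Qed.

(** At a net point, the upper bound adds the largest signal to the largest noise, and the lower
    bound uses the index of [e_lb], where both are large at once; subtracting b leaves errors t and
    s + t. Lipschitz continuity extends this to the sphere. *)
Lemma support_est_close u : enorm u = 1 ->
  `|support_est b Y u - suppf G u| <= eta.
Proof.
move=> u1; have [i ui] := net u1.
have L0 : 0 <= L by apply: le_trans (obs_norm_le (Ordinal n0)); exact: enorm_ge0.
have rho0 : 0 <= rho by apply: le_trans (x_le (Ordinal n0)); exact: enorm_ge0.
have iu : enorm (c i - u) <= mesh by rewrite enormB.
have h1 := support_est_lip b n0 u (c i) obs_norm_le.
have h2 := support_est_lip b n0 (c i) u obs_norm_le.
have h3 := suppf_lip u (c i) cG G0 GR.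
have h4 := suppf_lip (c i) u cG G0 GR.
have hu : support_est b Y (c i) <= suppf G (c i) + t.
  apply: support_est_le => // j; rewrite dotpDr.
  by have := suppf_ub (c i) GR (xG j); have := e_ub i j; lra.
have hl : suppf G (c i) - s - t <= support_est b Y (c i).
  have [j xj ej] := e_lb i.
  by have := support_est_ub Y b (c i) j; rewrite dotpDr; lra.
have m1 : enorm (u - c i) * L <= mesh * L by rewrite ler_wpM2r.
have m2 : enorm (c i - u) * L <= mesh * L by rewrite ler_wpM2r.
have m3 : rho * enorm (u - c i) <= rho * mesh by rewrite ler_wpM2l.
have m4 : rho * enorm (c i - u) <= rho * mesh by rewrite ler_wpM2l.
have up : support_est b Y u <= suppf G u + (t + mesh * L + rho * mesh).
  apply: le_trans h1 _; apply: le_trans (lerD hu m1) _.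
  have := le_trans h4 (lerD (lexx _) m4).
  move: (mesh * L) (rho * mesh) => p q; lra.
have lo : suppf G u - (s + t + mesh * L + rho * mesh) <= support_est b Y u.
  have := le_trans hl (le_trans h2 (lerD (lexx _) m2)).
  have := le_trans h3 (lerD (lexx _) m3).
  move: (mesh * L) (rho * mesh) => p q; lra.
have -> : eta = t + s + (mesh * L + rho * mesh) by rewrite /eta; ring.
rewrite ler_norml; move: (mesh * L) (rho * mesh) up lo s0 => p q; lra.
Qed.

Lemma sample_mean_norm_le : enorm (sample_mean Y) <= L.
Proof.
have n0R : 0 < n%:R :> R by rewrite ltr0n.
rewrite /sample_mean enormZ ger0_norm ?invr_ge0 ?ler0n//.
rewrite -(ler_pM2l n0R) mulrA divff ?gt_eqF// mul1r.
apply: le_trans (ler_enorm_sum _) _.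
apply: le_trans (ler_sum _ (fun j _ => obs_norm_le j)) _.
by rewrite sumr_const card_ord mulr_natl.
Qed.

Hypothesis U1 : forall k, enorm (U k) = 1.
Hypothesis Ucov : forall i, exists k, enorm (U k - c i) <= delta.
Hypothesis etar : 0 < eta <= r.
Hypotheses (delta0 : 0 <= delta) (dm : delta + mesh <= 2^-1).
Hypothesis Ln : L + rho <= ln n%:R.

Lemma hausdorff_dist_good_event :
  (hausdorff_dist (truncated_est b Y U) G <=
    (2 * (2 * rho * (delta + mesh) + eta) + eta / r * (2 * rho))%:E)%E.
Proof.
apply: (hausdorff_truncated_est_good bodyG aG GR) => //.
- by rewrite addr_ge0.
- move=> v v1; have [i vi] := net v1; have [k Uk] := Ucov i; exists k.
  rewrite -[U k](subrK (c i)) -addrA.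
  by apply: le_trans (ler_enormD _ _) _; rewrite lerD// enormB.
- exact: support_est_close.
- by apply: le_trans Ln; rewrite lerD2r; exact: sample_mean_norm_le.
Qed.

End good_event.

(** * Non-asymptotic risk bound *)

Section risk_bound.
Variables (R : realType) (d n M : nat) (disp : measure_display).
Variables (Omega : measurableType disp) (P : probability Omega R).
Variables (X eps : 'I_n -> {RV P >-> 'rV[R]_d}) (U : 'I_M -> {RV P >-> 'rV[R]_d}).
Variables (sigma : R) (G : set 'rV[R]_d) (a : 'rV[R]_d) (r Rad : R).
Variables (b t s delta kappa : R) (m : nat).
(* t: deviation of the noise maxima from b; s: height of the caps of G that
   must be hit; delta: covering radius of the random directions; d / m: mesh of
   the deterministic net on which the deviations are controlled. *)
Let mesh : R := d%:R / m%:R.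
Let L := Rad + 2 * (b + t).
Let eta := t + s + mesh * (Rad + L).
(** Lower bounds on three probabilities: [p] that a given X_j falls in a cap of height [s], [q] that
    a noise exceeds [b - t] in a given direction (density integrated over [b - t, b - t/2]), [q']
    that a random direction is within [delta] of a given unit vector. [pbad] is the union bound over
    the net. *)
Let p := (s * r / (2 * d%:R * Rad ^+ 2)) ^+ d.
Let q := t / 2 * normal_peak sigma * expR (- (b - t / 2) ^+ 2 / (2 * sigma ^+ 2)).
Let q' : R := (delta / (4 * d%:R)) ^+ d.-1 / (6 * d%:R * 2 ^+ d).
Let pbad := ((2 * m).+1 ^ d)%:R *
  (n%:R * expR (- (b + t) ^+ 2 / (2 * sigma ^+ 2)) +
   expR (- (n%:R * (p * q))) + expR (- (M%:R * q'))).
Let risk_good := 2 * (2 * Rad * (delta + mesh) + eta) + eta / r * (2 * Rad).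

Hypothesis d0 : (0 < d)%N.
Hypothesis n1 : (1 < n)%N.
Hypothesis m0 : (0 < m)%N.
Hypothesis sigma0 : 0 < sigma.
Hypothesis model : noisy_body_model sigma G X eps U.
Hypothesis bodyG : convex_body G.
Hypothesis aG : eball a r `<=` G.
Hypothesis GR : G `<=` eball 0 Rad.
Hypotheses (r0 : 0 < r) (Rad0 : 0 < Rad).
Hypotheses (t0 : 0 <= t) (bt : t <= b) (s0 : 0 <= s) (sR : s <= 2 * Rad).
Hypotheses (delta0 : 0 < delta) (dm : delta + mesh <= 2^-1).
Hypotheses (eta0 : 0 < eta) (etar : eta <= r).
Hypothesis Ln : L + Rad <= ln n%:R.
Hypothesis kappa0 : 0 < kappa.

Let cG : compact G. Proof. by case: bodyG. Qed.
Let G0 : G !=set0.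
Proof. by exists a; apply: aG; rewrite /eball/= subrr enorm0 ltW. Qed.
Let mesh0 : 0 <= mesh. Proof. by rewrite divr_ge0. Qed.
Let uX j : uniform_on G (X j). Proof. by case: model. Qed.
Let gE j : isotropic_gaussian sigma (eps j). Proof. by case: model. Qed.
Let uU k : uniform_on_sphere (U k). Proof. by case: model. Qed.

Let Y w j := X j w + eps j w.
Let Uw w := U ^~ w.
Let dH w := hausdorff_dist (truncated_est b (Y w) (Uw w)) G.

Lemma bad_event : exists bad : set Omega,
  [/\ measurable bad, (P bad <= pbad%:E)%E &
    forall w, ~ bad w -> (dH w <= risk_good%:E)%E].
Proof.
have [I [c [cardI c1 net]]] := sphere_net R d0 m0.
(* Failures: [B1] a noise too large, [B2] no observation with both a signal in the cap and a large
   noise, [B3] no random direction near a net point. [B4] and [B5] are null events, removed so that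
   the almost sure constraints on U and X hold surely. *)
pose B1 (ij : I * 'I_n) := [set w | b + t <= dotp (c ij.1) (eps ij.2 w)].
pose capX i := [set x | suppf G (c i) - s <= dotp (c i) x].
pose capE i := [set x | b - t <= dotp (c i) x].
pose B2 i := \bigcap_(j in [set: 'I_n]) ~` (X j @^-1` capX i `&` eps j @^-1` capE i).
pose B3 i := \bigcap_(k in [set: 'I_M]) ~` (U k @^-1` eball (c i) delta).
pose B4 k := U k @^-1` ~` [set u | enorm u = 1].
pose B5 j := X j @^-1` ~` G.
have mB1 ij : measurable (B1 ij).
  exact: (measurable_preimage (eps ij.2) (measurable_halfspace_ge _ _)).
have mB2 i : measurable (B2 i).
  apply: fin_bigcap_measurable; first exact: finite_finset.
  move=> j _; apply: measurableC; apply: measurableI;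
    apply: measurable_preimage; exact: measurable_halfspace_ge.
have mB3 i : measurable (B3 i).
  apply: fin_bigcap_measurable; first exact: finite_finset.
  by move=> j _; apply: measurableC; apply: measurable_preimage; exact: measurable_eball.
have mB4 k : measurable (B4 k).
  by apply: measurable_preimage; apply: measurableC; exact: measurable_sphere.
have mB5 j : measurable (B5 j).
  by apply: measurable_preimage; apply: measurableC; exact: measurable_compact.
have [mS1 PS1] := probability_bigsetU_le P mB1.
have [mS2 PS2] := probability_bigsetU_le P mB2.
have [mS3 PS3] := probability_bigsetU_le P mB3.
have [mS4 PS4] := probability_bigsetU_le P mB4.
have [mS5 PS5] := probability_bigsetU_le P mB5.
have b0 : 0 <= b by exact: le_trans bt.
have mS12 := measurableU _ _ mS1 mS2.
have mS123 := measurableU _ _ mS12 mS3.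
have mS45 := measurableU _ _ mS4 mS5.
exists ((\big[setU/set0]_ij B1 ij `|` \big[setU/set0]_i B2 i `|` \big[setU/set0]_i B3 i) `|`
  (\big[setU/set0]_k B4 k `|` \big[setU/set0]_j B5 j)).
split.
- exact: measurableU.
- apply: le_trans (measureU2 _ _ _) _ => //.
  rewrite -[leRHS]adde0; apply: leeD; last first.
    apply: le_trans (measureU2 _ _ _) _ => //; rewrite -[leRHS]adde0; apply: leeD.
      apply: le_trans PS4 _; rewrite big1// => k _.
      exact: uniform_on_sphere_norm.
    apply: le_trans PS5 _; rewrite big1// => j _.
    exact: uniform_on_outside.
  rewrite /pbad !mulrDr !EFinD.
  apply: le_trans (measureU2 _ _ _) _ => //.
  apply: leeD; last first.
    apply: le_trans PS3 _.
    rewrite -cardI mulr_natl -sumr_const -sumEFin; apply: lee_sum => i _.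
    case: model => _ _ _ indep.
    apply: (prob_no_direction_in indep); first exact: measurable_eball.
    move=> k; apply: uniform_on_sphere_cap => //; rewrite delta0/=.
    by have := dm; have := mesh0; lra.
  apply: le_trans (measureU2 _ _ _) _ => //; apply: leeD; last first.
    apply: le_trans PS2 _.
    rewrite -cardI mulr_natl -sumr_const -sumEFin; apply: lee_sum => i _.
    case: model => _ _ _ indep.
    apply: (prob_no_joint_success indep).
    + exact: measurable_halfspace_ge.
    + exact: measurable_halfspace_ge.
    + apply: exprn_ge0; apply: divr_ge0; first exact: mulr_ge0 s0 (ltW r0).
      by apply: mulr_ge0; [exact: mulr_ge0|exact: sqr_ge0].
    + by rewrite !mulr_ge0// ?normal_peak_ge0 ?expR_ge0.
    + by move=> j; apply: (uniform_on_cap d0 bodyG aG GR) => //; rewrite s0.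
    + move=> j; rewrite (isotropic_gaussian_itv (gE j))//.
      rewrite /q; have -> : b - t / 2 = b - t + t / 2 by field.
      by apply: normal_tail_ge; rewrite ?subr_ge0 ?divr_ge0.
  apply: le_trans PS1 _.
  rewrite mulrA -natrM -cardI -[X in (_ * X)%N]card_ord -card_prod.
  rewrite mulr_natl -sumr_const -sumEFin; apply: lee_sum => ij _.
  by apply: isotropic_gaussian_tail_le => //; rewrite addr_ge0.
- move=> w /not_orP[/not_orP[/not_orP[N1 N2] N3] /not_orP[N4 N5]].
  apply: (@hausdorff_dist_good_event R d n M (X ^~ w) (eps ^~ w) (U ^~ w)
    G a r Rad b t s delta mesh I c) => //.
  + exact: ltnW.
  + move=> j; apply: contrapT => h; apply: N5; exact: (@subset_bigsetU _ _ _ B5 j).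
  + move=> i j; rewrite leNgt; apply/negP => h; apply: N1.
    by apply: (@subset_bigsetU _ _ _ B1 (i, j)); exact: ltW.
  + move=> i; apply: contrapT => h; apply: N2.
    apply: (@subset_bigsetU _ _ _ B2 i) => j _ [xj ej]; apply: h.
    by exists j.
  + by have := dm; have := delta0; lra.
  + by rewrite addr_ge0.
  + move=> k; apply: contrapT => h; apply: N4; exact: (@subset_bigsetU _ _ _ B4 k).
  + move=> i; apply: contrapT => h; apply: N3.
    apply: (@subset_bigsetU _ _ _ B3 i) => k _ ui; apply: h.
    by exists k.
  + by rewrite eta0.
  + exact: ltW.
Qed.

Let sq w := \sum_(j < n) \sum_(i < d) (eps j w 0 i) ^+ 2.

(** The splitting gives a constant, charged later on the bad event only, plus a quadratic term whose
    expectation over the whole space is of order 1 / [kappa]. *)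
Lemma sample_mean_norm_crude w : (forall j, G (X j w)) ->
  enorm (sample_mean (Y w)) <= Rad + d%:R * kappa + (n%:R * kappa)^-1 * sq w.
Proof.
move=> XG; have n0R : 0 < n%:R :> R by rewrite ltr0n ltnW.
rewrite /sample_mean enormZ ger0_norm ?invr_ge0 ?ler0n//.
rewrite -(ler_pM2l n0R) [leLHS]mulrA mulfV ?gt_eqF// mul1r.
have -> : n%:R * (Rad + d%:R * kappa + (n%:R * kappa)^-1 * sq w) =
    n%:R * (Rad + d%:R * kappa) + kappa^-1 * sq w.
  by field; rewrite !gt_eqF.
apply: le_trans (ler_enorm_sum _) _.
have -> : n%:R * (Rad + d%:R * kappa) + kappa^-1 * sq w =
    \sum_(j < n) (Rad + \sum_(i < d) (kappa + kappa^-1 * eps j w 0 i ^+ 2)).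
  have inner j : \sum_(i < d) (kappa + kappa^-1 * eps j w 0 i ^+ 2) =
      d%:R * kappa + kappa^-1 * \sum_(i < d) eps j w 0 i ^+ 2.
    by rewrite big_split/= sumr_const card_ord -mulr_sumr mulr_natl.
  under eq_bigr do rewrite inner addrA.
  rewrite big_split/= sumr_const card_ord -mulr_sumr.
  by rewrite mulr_natl.
apply: ler_sum => j _; apply: le_trans (ler_enormD _ _) _.
apply: lerD; first by have := GR (XG j); rewrite /eball/= subr0.
apply: le_trans (enorm_le_sum _) _; apply: ler_sum => i _.
set y := eps j w 0 i.
(* |y| <= kappa + y^2 / kappa *)
rewrite -(ler_pM2l kappa0) mulrDr mulrA divff ?gt_eqF// mul1r.
have : y ^+ 2 = `|y| ^+ 2 by rewrite real_normK ?num_real.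
move=> ->; have := sqr_ge0 (`|y| - kappa); have := sqr_ge0 (`|y|); have := sqr_ge0 kappa.
by nra.
Qed.

Lemma risk_le :
  (\int[P]_w dH w <=
    (risk_good + (2 * Rad + ln n%:R + d%:R * kappa) * pbad +
       4 * d%:R * sigma ^+ 2 / kappa)%:E)%E.
Proof.
have n0R : 0 < n%:R :> R by rewrite ltr0n ltnW.
have nk0 : 0 < n%:R * kappa by rewrite mulr_gt0.
have lnn0 : 0 <= ln (n%:R : R) by rewrite ln_ge0// ler1n ltnW.
have C0 : 0 <= 2 * Rad + ln n%:R + d%:R * kappa.
  by rewrite !addr_ge0// mulr_ge0 ?ler0n// ltW.
have rg0 : 0 <= risk_good.
  have R0 := ltW Rad0; have e0 := ltW eta0; have dl0 := ltW delta0.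
  apply: addr_ge0; apply: mulr_ge0 => //; last exact: mulr_ge0.
    by apply: addr_ge0 => //; apply: mulr_ge0; [exact: mulr_ge0|exact: addr_ge0].
  exact: divr_ge0 e0 (ltW r0).
have [bad [mbad Pbad badP]] := bad_event.
have mB5 j : measurable (X j @^-1` ~` G).
  by apply: measurable_preimage; apply: measurableC; exact: measurable_compact.
have [mout Pout] := probability_bigsetU_le P mB5.
set out := \big[setU/set0]_j _ in mout Pout.
have Pout0 : P out = 0%E.
  apply/eqP; rewrite eq_le measure_ge0 andbT; apply: le_trans Pout _.
  by rewrite big1// => j _; exact: uniform_on_outside.
have sq0 w : 0 <= sq w.
  by apply: sumr_ge0 => j _; apply: sumr_ge0 => i _; exact: sqr_ge0.
have mcoord j i : measurable_fun setT (fun w => eps j w 0 i).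
  rewrite (_ : (fun w => _) = (fun w => dotp (delta_mx 0 i) (eps j w))); last first.
    by apply/funext => w; rewrite dotp_delta.
  by apply: measurableT_comp; [exact: measurable_fun_dotp|exact: measurable_funPT].
have Isq : (\int[P]_w (sq w)%:E <= (n%:R * d%:R * (4 * sigma ^+ 2))%:E)%E.
  under eq_integral do rewrite /sq -sumEFin.
  rewrite ge0_integral_sum//; last 2 first.
  - move=> j; apply/measurable_EFinP; apply: measurable_sum => i.
    exact: measurable_funX.
  - by move=> j w _; rewrite lee_fin; apply: sumr_ge0 => i _; exact: sqr_ge0.
  apply: (@le_trans _ _ (\sum_(j < n) \sum_(i < d) (4 * sigma ^+ 2)%:E)%E); last first.
    rewrite (eq_bigr (fun=> (d%:R * (4 * sigma ^+ 2))%:E)); last first.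
      by move=> j _; rewrite sumEFin sumr_const card_ord (mulr_natl (4 * sigma ^+ 2) d).
    by rewrite sumEFin sumr_const card_ord lee_fin -[leRHS]mulrA [leRHS]mulr_natl.
  apply: lee_sum => j _; under eq_integral do rewrite -sumEFin.
  rewrite ge0_integral_sum//; last 2 first.
  - by move=> i; apply/measurable_EFinP; exact: measurable_funX.
  - by move=> i w _; rewrite lee_fin sqr_ge0.
  apply: lee_sum => i _.
  have := isotropic_gaussian_second_moment sigma0 (gE j) (enorm_delta R i).
  congr (_ <= _)%E; apply: eq_integral => w _.
  by rewrite dotp_delta.
have msq : measurable_fun setT (EFin \o sq).
  apply/measurable_EFinP; apply: measurable_sum => j; apply: measurable_sum => i.
  exact: measurable_funX.
(* The loss is dominated pointwise by a sum of three measurable functions, and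
   [ge0_le_integral_nomeas] compares the integrals without establishing that the loss is
   measurable. *)
pose g1 w : \bar R := (risk_good + (2 * Rad + ln n%:R + d%:R * kappa) * \1_bad w)%:E.
pose g2 w : \bar R := (((n%:R * kappa)^-1)%:E * (sq w)%:E)%E.
(* The loss is not bounded where some X j leaves G, which happens with
   probability 0. *)
pose g3 : Omega -> \bar R := (cst +oo%E) \_ out.
have g10 w : (0 <= g1 w)%E.
  by rewrite lee_fin addr_ge0// mulr_ge0// indicE ler0n.
have g20 w : (0 <= g2 w)%E by rewrite mule_ge0// lee_fin ?invr_ge0 ?(ltW nk0).
have g30 w : (0 <= g3 w)%E by rewrite /g3 patchE; case: ifP => _; rewrite /= ?leey.
have mg1 : measurable_fun setT g1.
  by apply/measurable_EFinP; apply: measurable_funD => //; apply: measurable_funM.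
have mg2 : measurable_fun setT g2 by exact: measurable_funeM.
have mg3 : measurable_fun setT g3.
  by apply/(measurable_restrictT _ mout); exact: measurable_cst.
apply: (@le_trans _ _ (\int[P]_w (g1 w + g2 w + g3 w))%E).
  apply: ge0_le_integral_nomeas => w; first exact: hausdorff_dist_ge0.
  rewrite /g3 patchE; case: ifPn => [_|wout].
    by rewrite addey ?leey// -ltNye
      (lt_le_trans _ (adde_ge0 (g10 w) (g20 w)))// ltNy0.
  have XG j : G (X j w).
    apply: contrapT => h; move/negP: wout; apply; apply/mem_set.
    exact: (@subset_bigsetU _ _ _ (fun j => X j @^-1` ~` G) j).
  rewrite [point]/(0%E) adde0 /g1 indicE.
  have [wbad|/negP wbad] := boolP (w \in bad).
    rewrite mulr1 /g2 -EFinM -EFinD.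
    apply: le_trans (hausdorff_truncated_est_crude _ _ _ G0 GR n1) _.
    by rewrite lee_fin; have := sample_mean_norm_crude XG; have := rg0; lra.
  rewrite mulr0 addr0 -[leLHS]adde0; apply: leeD => //.
  by apply: badP => /mem_set.
rewrite ge0_integralD//; last 2 first.
- by move=> w _; exact: adde_ge0.
- exact: emeasurable_funD.
rewrite ge0_integralD//.
have -> : (\int[P]_w g3 w = 0)%E.
  transitivity (+oo * P out)%E; last by rewrite Pout0 mule0.
  by rewrite -integral_mkcond; exact: integral_cst.
rewrite adde0 [leRHS]EFinD; apply: leeD.
  rewrite /g1; under eq_integral do rewrite EFinD EFinM.
  rewrite ge0_integralD//; last 2 first.
  - by move=> w _; rewrite mule_ge0// lee_fin// indicE.
  - by apply: measurable_funeM; apply/measurable_EFinP.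
  have -> : (\int[P]_w risk_good%:E = risk_good%:E)%E.
    transitivity (risk_good%:E * P setT)%E; first exact: integral_cst.
    by rewrite probability_setT mule1.
  rewrite (EFinD risk_good); apply: leeD => //.
  rewrite ge0_integralZl//; last by apply/measurable_EFinP.
  by rewrite integral_indic// setIT EFinM; apply: lee_wpmul2l.
rewrite /g2 ge0_integralZl//; last 2 first.
- by move=> w _; rewrite lee_fin.
- by rewrite lee_fin invr_ge0 ltW.
apply: (@le_trans _ _ (((n%:R * kappa)^-1)%:E * (n%:R * d%:R * (4 * sigma ^+ 2))%:E)%E).
  by apply: lee_wpmul2l => //; rewrite lee_fin invr_ge0 ltW.
rewrite -EFinM lee_fin le_eqVlt; apply/orP; left; apply/eqP.
by field; rewrite !gt_eqF.
Qed.

End risk_bound.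

(** * Asymptotics *)

Section asymptotics.
Variable R : realType.

Lemma ln_le_id (x : R) : 0 < x -> ln x <= x.
Proof. by move=> x0; rewrite -{2}(lnK x0); have := expR_ge1Dx (ln x); lra. Qed.

(** ln x = 2 ln (sqrt x) <= 2 sqrt x, so the quotient is at most 2 / sqrt x. *)
Lemma ln_div_le (x eps : R) : 0 < eps -> (2 / eps) ^+ 2 <= x -> ln x / x <= eps.
Proof.
move=> eps0 hx.
have x0 : 0 < x by apply: lt_le_trans hx; rewrite exprn_gt0// divr_gt0.
have sx0 : 0 < Num.sqrt x by rewrite sqrtr_gt0.
have sx2 : Num.sqrt x ^+ 2 = x by rewrite sqr_sqrtr// ltW.
rewrite ler_pdivrMr//.
have -> : ln x = 2 * ln (Num.sqrt x) by rewrite -{1}sx2 lnXn// mulr_natl.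
have h : 2 / eps <= Num.sqrt x.
  by rewrite -(@ler_pXn2r _ 2)// ?nnegrE ?sx2 ?(ltW sx0)// divr_ge0// ltW.
have -> : eps * x = eps * Num.sqrt x * Num.sqrt x by rewrite -mulrA -expr2 sx2.
apply: (@le_trans _ _ (2 * Num.sqrt x)); first by rewrite ler_pM2l//; exact: ln_le_id.
by rewrite ler_pM2r// mulrC -ler_pdivrMr.
Qed.

Lemma expR_natM_ln (x : R) (k : nat) : 0 < x -> expR (k%:R * ln x) = x ^+ k.
Proof. by move=> x0; rewrite expRM_natl lnK. Qed.

Variables (d : nat) (sigma r Rad K b : R) (n : nat).
Hypothesis hd : (2 <= d)%N.
Hypothesis sigma0 : 0 < sigma.
Hypotheses (r0 : 0 < r) (Rad0 : 0 < Rad).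
(** The net of mesh d/m, with m close to b^2, has of order b^(2d) points; failure probabilities b^-N
    leave b^-4 after the union bound. *)
Let N := (2 * d + 4)%N.
Let lb := ln b.
Let t := K * (lb / b).
Hypothesis nb : ln (n%:R : R) = b ^+ 2 / (2 * sigma ^+ 2).
Hypothesis n0 : (0 < n)%N.
Hypothesis K1 : 1 <= K.
Hypothesis lb1 : 1 <= lb.
Hypothesis t1 : t <= 1.

Let dR : 0 < d%:R :> R. Proof. by rewrite ltr0n ltnW. Qed.
Let s2 : 0 < sigma ^+ 2. Proof. exact: exprn_gt0. Qed.
Let b1 : 1 <= b.
Proof.
rewrite leNgt; apply/negP => bl; have := lb1; rewrite leNgt => /negP; apply.
by apply: le_lt_trans ltr01; exact: ln_le0 (ltW bl).
Qed.
Let b0 : 0 < b. Proof. exact: lt_le_trans b1. Qed.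
Let K0 : 0 < K. Proof. exact: lt_le_trans K1. Qed.
Let lb0 : 0 < lb. Proof. exact: lt_le_trans lb1. Qed.
Let bt : b * t = K * lb. Proof. by rewrite /t; field; rewrite gt_eqF. Qed.
Let t0 : 0 < t. Proof. by rewrite mulr_gt0// divr_gt0. Qed.
Let nE : n%:R = expR (b ^+ 2 / (2 * sigma ^+ 2)) :> R.
Proof. by rewrite -nb lnK// posrE ltr0n. Qed.
Let expN : expR (- (N%:R * lb)) = b ^- N.
Proof. by rewrite expRN expR_natM_ln. Qed.

(** The factor n cancels exp(- b^2 / (2 sigma^2)), and what remains is at most exp(- b t / sigma^2)
    with b t = K ln b. *)
Lemma noise_term_le : N%:R * sigma ^+ 2 <= K ->
  n%:R * expR (- (b + t) ^+ 2 / (2 * sigma ^+ 2)) <= b ^- N.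
Proof.
move=> hK; rewrite -expN nE -expRD ler_expR.
have -> : b ^+ 2 / (2 * sigma ^+ 2) + - (b + t) ^+ 2 / (2 * sigma ^+ 2) =
    - ((b * t) / sigma ^+ 2 + t ^+ 2 / (2 * sigma ^+ 2)).
  by field; rewrite gt_eqF.
rewrite lerN2 bt.
have : N%:R * lb <= K * lb / sigma ^+ 2.
  by rewrite ler_pdivlMr// mulrAC ler_pM2r.
have : 0 <= t ^+ 2 / (2 * sigma ^+ 2).
  by apply: divr_ge0; [exact: sqr_ge0|apply: mulr_ge0 => //; exact: ltW].
lra.
Qed.

(** Multiplied by n, the Gaussian factor is at least a constant times exp(b t / (2 sigma^2)), hence
    times b^(d+3). The factor t^(d+1) costs at most b^(d+1), as t >= 1/b. The expected number of
    successes is thus at least c b^2 >= N b >= N ln b. *)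
Lemma data_term_le (c := (r / (2 * d%:R * Rad ^+ 2)) ^+ d * normal_peak sigma *
      expR (- (8 * sigma ^+ 2)^-1) / 2) :
  2 * sigma ^+ 2 * (d + 3)%:R <= K -> N%:R / c <= b ->
  expR (- (n%:R * ((t * r / (2 * d%:R * Rad ^+ 2)) ^+ d *
     (t / 2 * normal_peak sigma * expR (- (b - t / 2) ^+ 2 / (2 * sigma ^+ 2))))))
  <= b ^- N.
Proof.
move=> hK hb; rewrite -expN ler_expR lerN2.
have pk : 0 < normal_peak sigma by rewrite normal_peak_gt0// gt_eqF.
set c1 := r / (2 * d%:R * Rad ^+ 2) in c hb *.
have c10 : 0 < c1 by rewrite /c1 divr_gt0// mulr_gt0 ?exprn_gt0// mulr_gt0.
have c0 : 0 < c by rewrite divr_gt0// !mulr_gt0 ?expR_gt0 ?exprn_gt0.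
have c1E : r / (2 * d%:R * Rad ^+ 2) = c1 by [].
clearbody c1.
have tb : b^-1 <= t.
  rewrite -[b^-1]mul1r ler_pdivrMr// mulrC bt.
  exact: mulr_ege1.
have e1 : expR (- (8 * sigma ^+ 2)^-1) * b ^+ (d + 3) <=
    n%:R * expR (- (b - t / 2) ^+ 2 / (2 * sigma ^+ 2)).
  rewrite -(@expR_natM_ln b (d + 3))// nE -!expRD ler_expR.
  have -> : b ^+ 2 / (2 * sigma ^+ 2) + - (b - t / 2) ^+ 2 / (2 * sigma ^+ 2) =
      (b * t) / (2 * sigma ^+ 2) - t ^+ 2 / (8 * sigma ^+ 2).
    by field; rewrite gt_eqF.
  rewrite bt.
  have : (d + 3)%:R * lb <= K * lb / (2 * sigma ^+ 2).
    rewrite ler_pdivlMr ?mulr_gt0//.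
    by rewrite [leLHS]mulrC mulrA ler_pM2r// .
  have : t ^+ 2 / (8 * sigma ^+ 2) <= (8 * sigma ^+ 2)^-1.
    by rewrite ler_pdivrMr ?mulr_gt0// mulVf ?gt_eqF ?mulr_gt0// expr_le1// ltW.
  rewrite -/lb; lra.
have -> : t * r / (2 * d%:R * Rad ^+ 2) = t * c1 by rewrite -c1E mulrA.
have h : c * b ^+ 2 <= n%:R * ((t * c1) ^+ d *
    (t / 2 * normal_peak sigma * expR (- (b - t / 2) ^+ 2 / (2 * sigma ^+ 2)))).
  have -> : c * b ^+ 2 = (b^-1 * c1) ^+ d * (b^-1 / 2 * normal_peak sigma *
      (expR (- (8 * sigma ^+ 2)^-1) * b ^+ (d + 3))).
    rewrite /c [(b^-1 * c1) ^+ d]exprMn exprVn exprD.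
    have bd : 0 < b ^+ d by rewrite exprn_gt0.
    by field; rewrite !gt_eqF.
  set E := expR (- (b - t / 2) ^+ 2 / _) in e1 *.
  have -> : n%:R * ((t * c1) ^+ d * (t / 2 * normal_peak sigma * E)) =
      (t * c1) ^+ d * (t / 2 * normal_peak sigma * (n%:R * E)) by ring.
  have bi : 0 < b^-1 by rewrite invr_gt0.
  apply: ler_pM; rewrite ?exprn_ge0 ?mulr_ge0 ?invr_ge0 ?expR_ge0 ?exprn_ge0 ?(ltW b0) ?(ltW c10) ?(ltW pk)//.
    apply: lerXn2r; rewrite ?nnegrE.
    - exact: mulr_ge0 (ltW bi) (ltW c10).
    - exact: mulr_ge0 (ltW t0) (ltW c10).
    - by rewrite ler_pM2r.
  apply: ler_pM => //; rewrite ?mulr_ge0 ?invr_ge0 ?expR_ge0 ?exprn_ge0 ?(ltW b0) ?(ltW pk)//.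
  by rewrite ler_pM2r// ler_pM2r.
apply: le_trans h; apply: (@le_trans _ _ (N%:R * b)).
  by rewrite ler_wpM2l ?ler0n//; exact: ln_le_id.
rewrite expr2 mulrA ler_pM2r// mulrC.
by rewrite -ler_pdivrMr.
Qed.

(** Since b t = K ln b, the product of M and t^(d-1) is at least K^(d-1) (ln b)^(d-1) / (ln
    b)^(d-2): exactly one factor ln b survives, and K makes its coefficient at least N. *)
Lemma direction_term_le (M : nat) :
  4 * d%:R * (N%:R * (6 * d%:R * 2 ^+ d)) <= K ->
  b ^+ d.-1 / lb ^+ d.-2 <= M%:R ->
  expR (- (M%:R * ((t / (4 * d%:R)) ^+ d.-1 / (6 * d%:R * 2 ^+ d)))) <= b ^- N.
Proof.
move=> hK hM; rewrite -expN ler_expR lerN2.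
have Z0 : 0 < 6 * d%:R * 2 ^+ d :> R by rewrite mulr_gt0 ?exprn_gt0// mulr_gt0.
set Z := 6 * d%:R * 2 ^+ d in Z0 hK *.
have t40 : 0 <= (t / (4 * d%:R)) ^+ d.-1 / Z.
  apply: divr_ge0 (ltW Z0); apply: exprn_ge0; apply: divr_ge0 (ltW t0) _.
  by rewrite mulr_ge0.
apply: le_trans (ler_wpM2r t40 hM).
have de : d = d.-2.+2 by rewrite -subn2 -addn2 subnK.
set e := d.-2 in de *; have -> : d.-1 = e.+1 by rewrite de.
have KZ : N%:R * Z <= (K / (4 * d%:R)) ^+ e.+1.
  have kd : N%:R * Z <= K / (4 * d%:R).
    by rewrite ler_pdivlMr ?mulr_gt0// mulrC.
  apply: le_trans kd _; rewrite exprS ler_peMr ?divr_ge0 ?mulr_ge0 ?(ltW K0) ?(ltW dR)//.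
  rewrite exprn_ege1// ler_pdivlMr ?mulr_gt0// mul1r; apply: le_trans hK.
  rewrite ler_peMr ?mulr_ge0 ?(ltW dR)//.
  have N1 : 1 <= N%:R :> R by rewrite ler1n /N addnS.
  have Z1 : 1 <= Z.
    have d1 : 1 <= d%:R :> R by rewrite ler1n ltnW.
    have p1 : 1 <= 2 ^+ d :> R by rewrite exprn_ege1// ler1n.
    have h6 : 1 <= 6 * d%:R :> R by lra.
    exact: mulr_ege1.
  exact: mulr_ege1.
have -> : b ^+ e.+1 / lb ^+ e * ((t / (4 * d%:R)) ^+ e.+1 / Z) =
    (K / (4 * d%:R)) ^+ e.+1 / Z * lb.
  have -> : t / (4 * d%:R) = K / (4 * d%:R) * lb / b.
    by rewrite /t; field; rewrite !gt_eqF.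
  rewrite !exprMn !exprVn [lb ^+ e.+1]exprS.
  have p1 : 0 < b ^+ e.+1 by rewrite exprn_gt0.
  have p2 : 0 < lb ^+ e by rewrite exprn_gt0.
  set u := (K ^+ _ * _).
  by field; rewrite !gt_eqF.
by rewrite ler_pM2r// ler_pdivlMr.
Qed.

(** For x = b^(d-1) / (ln b)^(d-2) >= 1 and A >= 2, the integer part of A x exceeds A x - 1 >= x. *)
Lemma nb_directions_ge : b = bn sigma n ->
  b ^+ d.-1 / lb ^+ d.-2 <= (nb_directions d sigma n)%:R.
Proof.
move=> bE; rewrite /nb_directions -bE -/lb.
set A := 2 * d%:R * (d%:R + 1) * 8 `^ _.
have A2 : 2 <= A.
  have d1 : 1 <= d%:R :> R by rewrite ler1n ltnW.
  have p1 : 1 <= 8 `^ (d.-1%:R / 2) :> R.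
    rewrite /powR ifF; last by apply/negbTE; rewrite gt_eqF.
    rewrite -[leLHS]expR0 ler_expR mulr_ge0 ?divr_ge0 ?ln_ge0 ?ler0n//.
    by rewrite ler1n.
  have : 2 <= 2 * d%:R * (d%:R + 1) :> R by nra.
  by move=> h; rewrite /A; nra.
rewrite -mulrA; set x := b ^+ d.-1 / lb ^+ d.-2.
have x1 : 1 <= x.
  rewrite /x ler_pdivlMr ?exprn_gt0// mul1r.
  have -> : d.-1 = d.-2.+1 by rewrite prednK// -ltnS prednK// ltnW.
  rewrite exprS -[leLHS]mul1r ler_pM ?exprn_ge0 ?(ltW lb0)//.
  by rewrite lerXn2r ?nnegrE ?(ltW lb0) ?(ltW b0)//; exact: ln_le_id.
have := truncnS_gt (A * x); rewrite -natr1.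
have : 2 * x <= A * x by rewrite ler_pM2r// (lt_le_trans ltr01).
lra.
Qed.

Variable m : nat.
Hypothesis bm : b ^+ 2 <= m%:R.
Hypothesis mb : m%:R <= b ^+ 2 + 1.
Let mesh : R := d%:R / m%:R.
Let L := Rad + 2 * (b + t).
Let eta := t + t + mesh * (Rad + L).
Let Ceta := 2 * K + d%:R * (2 * Rad + 4).

Let m0 : 0 < m%:R :> R. Proof. by apply: lt_le_trans bm; exact: exprn_gt0. Qed.
Let w0 : 0 < lb / b. Proof. exact: divr_gt0. Qed.
Let invb_le : b^-1 <= lb / b.
Proof. by rewrite -[leLHS]mul1r ler_pM2r// invr_gt0. Qed.

Let mesh_le : mesh <= d%:R / b * b^-1.
Proof.
by rewrite /mesh -mulrA ler_pM2l// -invfM lef_pV2 ?posrE ?mulr_gt0// -expr2.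
Qed.

Lemma mesh_le_rate : mesh <= d%:R * (lb / b).
Proof.
apply: le_trans mesh_le _; rewrite -mulrA ler_pM2l//.
apply: le_trans invb_le; rewrite ler_piMr ?invr_ge0 ?(ltW b0)//.
by rewrite invf_le1.
Qed.

(** [L] grows like b while the mesh is at most d / b^2, so their product is O(1/b), which is below
    the rate because ln b >= 1. *)
Lemma eta_le_rate : eta <= Ceta * (lb / b).
Proof.
have h : mesh * (Rad + L) <= d%:R * (2 * Rad + 4) * (lb / b).
  have hL : Rad + L <= (2 * Rad + 4) * b.
    have := t1; have := b1; have := Rad0; have : Rad <= Rad * b.
      by rewrite ler_peMr// ltW.
    rewrite /L; lra.
  apply: (@le_trans _ _ (d%:R / b * b^-1 * ((2 * Rad + 4) * b))).
    apply: ler_pM mesh_le hL; first by rewrite divr_ge0// ltW.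
    by rewrite /L !addr_ge0 ?mulr_ge0 ?addr_ge0 ?(ltW b0) ?(ltW Rad0)//; exact: ltW t0.
  have -> : d%:R / b * b^-1 * ((2 * Rad + 4) * b) = d%:R * (2 * Rad + 4) * b^-1.
    by field; rewrite gt_eqF.
  rewrite ler_wpM2l//; have := Rad0; have := dR; nra.
rewrite /eta /Ceta mulrDl; apply: lerD h.
by rewrite -mulr2n -[leLHS]mulr_natl /t mulrA.
Qed.

Lemma pbad_le (T1 T2 T3 : R) : T1 <= b ^- N -> T2 <= b ^- N -> T3 <= b ^- N ->
  ((2 * m).+1 ^ d)%:R * (T1 + T2 + T3) <= 3 * 5 ^+ d / b ^+ 4.
Proof.
move=> h1 h2 h3.
(* From m <= b^2 + 1 and b >= 1: 2m + 1 <= 2b^2 + 3 <= 5b^2. *)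
have m5 : (2 * m).+1%:R <= 5 * b ^+ 2.
  have b2 : 1 <= b ^+ 2 by rewrite exprn_ege1.
  by rewrite -natr1 natrM; have := mb; lra.
have -> : 3 * 5 ^+ d / b ^+ 4 = (5 * b ^+ 2) ^+ d * (3 * b ^- N).
  rewrite exprMn -exprM /N exprD mulnC.
  have p1 : 0 < b ^+ (d * 2) by rewrite exprn_gt0.
  by field; rewrite !gt_eqF.
have bN : 0 <= b ^- N by rewrite invr_ge0 exprn_ge0// ltW.
apply: (@le_trans _ _ (((2 * m).+1 ^ d)%:R * (3 * b ^- N))).
  by rewrite ler_wpM2l ?ler0n//; lra.
rewrite ler_wpM2r ?mulr_ge0// natrX lerXn2r ?nnegrE ?ler0n//.
by rewrite mulr_ge0// exprn_ge0// ltW.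
Qed.

(** The bound is compared term by term. As ln n is b^2 / (2 sigma^2), the crude loss is O(b^2), and
    times b^-4 it gives O(b^-2). *)
Lemma risk_rate (pb : R) : pb <= 3 * 5 ^+ d / b ^+ 4 ->
  2 * (2 * Rad * (t + mesh) + eta) + eta / r * (2 * Rad) +
  (2 * Rad + ln n%:R + d%:R * b) * pb + 4 * d%:R * sigma ^+ 2 / b <=
  (2 * (2 * Rad * (K + d%:R) + Ceta) + Ceta / r * (2 * Rad) +
   (2 * Rad + (2 * sigma ^+ 2)^-1 + d%:R) * (3 * 5 ^+ d) +
   4 * d%:R * sigma ^+ 2) * (lb / b).
Proof.
move=> hpb; set w := lb / b.
set A := 2 * Rad + (2 * sigma ^+ 2)^-1 + d%:R.
have -> : (2 * (2 * Rad * (K + d%:R) + Ceta) + Ceta / r * (2 * Rad) +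
    A * (3 * 5 ^+ d) + 4 * d%:R * sigma ^+ 2) * w =
  2 * ((2 * Rad * ((K + d%:R) * w)) + Ceta * w) + (Ceta * w) / r * (2 * Rad) +
    A * (3 * 5 ^+ d) * w + 4 * d%:R * sigma ^+ 2 * w by ring.
have hm := mesh_le_rate; have he := eta_le_rate.
apply: lerD; [apply: lerD; [apply: lerD|]|].
- rewrite ler_pM2l//; apply: lerD he; rewrite ler_pM2l ?mulr_gt0//.
  by rewrite [leRHS]mulrDl lerD2l.
- by rewrite ler_pM2r ?mulr_gt0// ler_pM2r ?invr_gt0.
- have l0 : 0 <= ln (n%:R : R) by rewrite nb divr_ge0 ?sqr_ge0// mulr_ge0// ltW.
  have s3 : 0 < 2 * sigma ^+ 2 by rewrite mulr_gt0.
  have db0 : 0 <= d%:R * b by rewrite mulr_ge0// ltW.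
  have R20 : 0 <= 2 * Rad by rewrite mulr_ge0// ltW.
  apply: le_trans (ler_wpM2l _ hpb) _; first by rewrite !addr_ge0.
  have b2 : 1 <= b ^+ 2 by rewrite exprn_ege1.
  have h : 2 * Rad + ln n%:R + d%:R * b <= A * b ^+ 2.
    rewrite nb /A [leRHS]mulrDl; apply: lerD.
      rewrite [leRHS]mulrDl; apply: lerD; first by rewrite ler_peMr.
      by rewrite [leRHS]mulrC.
    by rewrite ler_pM2l// expr2 ler_peMr// ltW.
  have D0 : 0 <= 3 * 5 ^+ d / b ^+ 4 :> R.
    by rewrite divr_ge0 ?mulr_ge0 ?exprn_ge0// ltW.
  apply: le_trans (ler_wpM2r D0 h) _.
  have -> : A * b ^+ 2 * (3 * 5 ^+ d / b ^+ 4) = A * (3 * 5 ^+ d) * (b^-1 * b^-1).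
    by field; rewrite gt_eqF.
  have A0 : 0 <= A by rewrite !addr_ge0// invr_ge0 ltW.
  rewrite ler_wpM2l ?mulr_ge0 ?exprn_ge0//.
  apply: le_trans invb_le; rewrite ler_piMr ?invr_ge0 ?(ltW b0)//.
  by rewrite invf_le1.
- by rewrite ler_pM2l// mulr_gt0// mulr_gt0.
Qed.

End asymptotics.

(** * Choice of the parameters and conclusion *)

Lemma bn_eventually_ge (R : realType) (sigma B : R) : 0 < sigma ->
  \forall n \near \oo, B <= bn sigma n.
Proof.
move=> s0; have s3 : 0 < 2 * sigma ^+ 2 by rewrite mulr_gt0// exprn_gt0.
exists (Num.truncn (expR (B ^+ 2 / (2 * sigma ^+ 2)))).+1 => // n /= hn.
have n0 : 0 < n%:R :> R by rewrite ltr0n; case: n hn.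
have h : B ^+ 2 / (2 * sigma ^+ 2) <= ln (n%:R : R).
  rewrite -ler_expR lnK ?posrE//; apply: ltW.
  by apply: lt_le_trans (truncnS_gt _) _; rewrite ler_nat.
rewrite /bn; apply: (le_trans (ler_norm B)).
rewrite -sqrtr_sqr ler_wsqrtr// mulrC -ler_pdivrMr//.
Qed.

Theorem corollary2 (R : realType) (d : nat) (sigma r Rad : R)
    (hd : (2 <= d)%N) (hsigma : 0 < sigma) (hr : 0 < r) (hrR : r <= Rad) :
  exists C : R, \forall n \near \oo,
    (maximal_risk d sigma n r Rad
       <= (C * (ln (ln n%:R) / Num.sqrt (ln n%:R)))%:E)%E.
Proof.
have Rad0 : 0 < Rad by exact: lt_le_trans hrR.
have d0 : (0 < d)%N by exact: ltnW.
have dR : 0 < d%:R :> R by rewrite ltr0n.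
have s2 : 0 < sigma ^+ 2 by exact: exprn_gt0.
have s3 : 0 < 2 * sigma ^+ 2 by rewrite mulr_gt0.
pose N : R := (2 * d + 4)%:R.
have N0 : 0 <= N by exact: ler0n.
(* One threshold on K for each of the three failure probabilities. *)
have [K [K1 KN Kd KM]] : exists K : R, [/\ 1 <= K, N * sigma ^+ 2 <= K,
    2 * sigma ^+ 2 * (d + 3)%:R <= K & 4 * d%:R * (N * (6 * d%:R * 2 ^+ d)) <= K].
  have h1 : 0 <= N * sigma ^+ 2 by rewrite mulr_ge0// ltW.
  have h2 : 0 <= 2 * sigma ^+ 2 * (d + 3)%:R by rewrite mulr_ge0// ltW.
  have h3 : 0 <= 4 * d%:R * (N * (6 * d%:R * 2 ^+ d)).
    by rewrite !mulr_ge0// exprn_ge0.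
  exists (1 + N * sigma ^+ 2 + 2 * sigma ^+ 2 * (d + 3)%:R +
    4 * d%:R * (N * (6 * d%:R * 2 ^+ d))).
  move: (N * _) (2 * sigma ^+ 2 * _) (4 * d%:R * _) h1 h2 h3 => x y z h1 h2 h3.
  by split; lra.
have K0 : 0 < K by exact: lt_le_trans K1.
have [Ceta CetaE] : {C | C = 2 * K + d%:R * (2 * Rad + 4)}.
  by exists (2 * K + d%:R * (2 * Rad + 4)).
have Ceta0 : 0 < Ceta.
  by rewrite CetaE addr_gt0 ?mulr_gt0// addr_gt0// mulr_gt0.
(* Once ln b / b <= 1/D, these four bounds give t <= 1, t <= 2 Rad, delta + mesh <= 1/2 and eta <=
   r. *)
have [D [D0 D1 D2 D3 D4]] : exists D : R, [/\ 0 < D, K <= D, K / (2 * Rad) <= D,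
    2 * (K + d%:R) <= D & Ceta / r <= D].
  have h1 : 0 < K / (2 * Rad) by rewrite divr_gt0// mulr_gt0.
  have h2 : 0 < 2 * (K + d%:R) by rewrite mulr_gt0// addr_gt0.
  have h3 : 0 < Ceta / r by rewrite divr_gt0.
  exists (K + K / (2 * Rad) + 2 * (K + d%:R) + Ceta / r).
  by move: (K / (2 * Rad)) (2 * (K + d%:R)) (Ceta / r) h1 h2 h3 => x y z h1 h2 h3; split; lra.
have [c [c0 cE]] : exists c : R, 0 < c /\
    c = (r / (2 * d%:R * Rad ^+ 2)) ^+ d * normal_peak sigma *
      expR (- (8 * sigma ^+ 2)^-1) / 2.
  eexists; split; last by [].
  rewrite divr_gt0// mulr_gt0 ?expR_gt0// mulr_gt0 ?normal_peak_gt0 ?gt_eqF//.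
  by rewrite exprn_gt0// divr_gt0// mulr_gt0 ?exprn_gt0// mulr_gt0.
pose C1 := 2 * (2 * Rad * (K + d%:R) + Ceta) + Ceta / r * (2 * Rad) +
   (2 * Rad + (2 * sigma ^+ 2)^-1 + d%:R) * (3 * 5 ^+ d) +
   4 * d%:R * sigma ^+ 2.
have C10 : 0 <= C1.
  rewrite /C1 !addr_ge0 ?mulr_ge0 ?addr_ge0 ?mulr_ge0 ?invr_ge0 ?exprn_ge0 ?addr_ge0 ?mulr_ge0 ?invr_ge0//;
  exact: ltW.
exists (C1 / Num.sqrt (2 * sigma ^+ 2)).
near=> n.
(* These thresholds on b give in turn ln b >= 1, ln b / b <= 1/D, the condition of [data_term_le], a
   truncation radius ln n large enough to contain G, and b <= ln n. *)
have b_e : expR 1 <= bn sigma n by near: n; exact: bn_eventually_ge.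
have b_D : (2 / D^-1) ^+ 2 <= bn sigma n by near: n; exact: bn_eventually_ge.
have b_c : N / c <= bn sigma n by near: n; exact: bn_eventually_ge.
have b_L : 2 * sigma ^+ 2 * (2 * Rad + 4) <= bn sigma n by near: n; exact: bn_eventually_ge.
have b_s : 2 * sigma ^+ 2 <= bn sigma n by near: n; exact: bn_eventually_ge.
set b := bn sigma n in b_e b_D b_c b_L b_s.
have b0 : 0 < b by apply: lt_le_trans b_e; exact: expR_gt0.
have lb1 : 1 <= ln b by rewrite -ler_expR lnK.
have b1 : 1 <= b by exact: le_trans lb1 (ln_le_id b0).
have lb0 : 0 < ln b by exact: lt_le_trans lb1.
have bsq : b ^+ 2 = 2 * sigma ^+ 2 * ln n%:R.
  (* The square root of a negative number is 0 by convention, which b > 0 excludes. *)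
  rewrite /b /bn sqr_sqrtr// leNgt; apply/negP => h.
  by move: b0; rewrite /b /bn ler0_sqrtr ?ltxx// ltW.
have nb : ln n%:R = b ^+ 2 / (2 * sigma ^+ 2) by rewrite bsq mulrC mulKf// gt_eqF.
have ln0 : 0 < ln (n%:R : R) by rewrite nb divr_gt0// exprn_gt0.
have n1 : (1 < n)%N.
  rewrite ltnNge; apply/negP => h; move: ln0; rewrite ltNge => /negP; apply.
  by apply: ln_le0; rewrite lern1.
have n0 : (0 < n)%N by exact: ltnW.
have w0 : 0 < ln b / b by rewrite divr_gt0.
have wD x : x <= D -> x * (ln b / b) <= 1.
  move=> xD; apply: (@le_trans _ _ (D * (ln b / b))); first by rewrite ler_pM2r.
  by rewrite -ler_pdivlMl// mulr1; apply: ln_div_le b_D; rewrite invr_gt0.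
pose t := K * (ln b / b).
have t1 : t <= 1 by exact: wD.
have t0 : 0 < t by rewrite mulr_gt0.
pose m := (Num.truncn (b ^+ 2)).+1.
have bm : b ^+ 2 <= m%:R by rewrite ltW// truncnS_gt.
have mb : m%:R <= b ^+ 2 + 1.
  by rewrite /m -natr1 lerD2r truncn_le exprn_ge0// ltW.
have meshle := mesh_le_rate hd lb1 bm.
have etale := eta_le_rate hd Rad0 K1 lb1 t1 bm.
rewrite -CetaE in etale.
apply: ge_ereal_sup => _ [G [bodyG [a [aG GR]]] [dO [Om [P [X [eps [U [model ->]]]]]]]].
have mesh0 : 0 <= d%:R / m%:R :> R by rewrite divr_ge0.
have L0 : 0 <= Rad + (Rad + 2 * (b + t)).
  by rewrite !addr_ge0 ?mulr_ge0 ?addr_ge0//; exact: ltW.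
(* The cap height, the covering radius and the noise deviation are all taken equal to t, and [kappa]
   to b. *)
apply: le_trans (@risk_le R d n (nb_directions d sigma n) dO Om P X eps U sigma
  G a r Rad b t t t b m d0 n1 _ hsigma model bodyG aG GR hr Rad0 _ _ _ _ t0 _ _ _ _ b0) _.
- by [].
- exact: ltW.
- exact: le_trans b1.
- exact: ltW.
- by have := wD _ D2; rewrite mulrAC ler_pdivrMr ?mulr_gt0// mul1r.
- have := wD _ D3; move: meshle; rewrite /t; lra.
- by rewrite ltr_pwDl ?addr_gt0// mulr_ge0.
- apply: le_trans etale _.
  by have := wD _ D4; rewrite mulrAC ler_pdivrMr// mul1r.
- rewrite nb ler_pdivlMr//; apply: (@le_trans _ _ (2 * sigma ^+ 2 * (2 * Rad + 4) * b)).
    rewrite mulrC -mulrA ler_pM2l//.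
    have : Rad <= Rad * b by rewrite ler_peMr// ltW.
    lra.
  by rewrite expr2 ler_pM2r.
rewrite lee_fin.
apply: le_trans (risk_rate _ _ _ _ nb K1 lb1 t1 bm _) _ => //.
  apply: (pbad_le lb1 mb).
  - exact: noise_term_le.
  - by apply: data_term_le => //; rewrite -cE.
  - exact: direction_term_le (nb_directions_ge hd lb1 (erefl _)).
rewrite -CetaE -/C1.
rewrite -mulrA ler_wpM2l//.
(* b is proportional to sqrt (ln n), and b <= ln n gives ln b <= ln (ln n). *)
have bE : b = Num.sqrt (2 * sigma ^+ 2) * Num.sqrt (ln n%:R).
  by rewrite /b /bn sqrtrM// ltW.
rewrite mulrCA -invfM -bE ler_pM2r ?invr_gt0// ler_ln ?posrE//.
by rewrite nb ler_pdivlMr// expr2 ler_pM2l.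
Unshelve. all: by end_near. Qed.
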